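(* Let $R$ be an indecomposable commutative ring and $\Gamma$ a (discrete) group with identity $\epsilon$. Suppose that $A=\bigoplus_{\gamma\in\Gamma}A_\gamma$ is a $\Gamma$-graded $R$-algebra, $C\subseteq A_\epsilon$ is a commutative subalgebra such that $C$ satisfies the without-torsion condition (WT), $I(C)$ forms a set of local units for $A_\epsilon$, $C=\mathrm{span}_R(I(C))$ and $A=\mathrm{span}_R(N_\star(C))$. Let $\Sigma_\star$ be the groupoid of ultrafilters on $N_\star(C)$, let $G_\star$ be the quotient of $\Sigma_\star$ by the equivalence relation $U\simeq W\iff U=tW$ for some $t\in R^\times$, and let $q:\Sigma_\star\to G_\star$ be the quotient map. Define $i:G_\star^{(0)}\times R^\times\to\Sigma_\star$ by $i(q(U),t)=tU$ for $U\in\Sigma_\star^{(0)}$ and $t\in R^\times$. Then the sequence $$G_\star^{(0)}\times R^\times\xrightarrow{\ i\ }\Sigma_\star\xrightarrow{\ q\ }G_\star,$$ together with the gradings $c_{\Sigma_\star}:\Sigma_\star\to\Gamma$ and $c_{G_\star}:G_\star\to\Gamma$, is a $\Gamma$-graded discrete $R$-twist over $G_\star$. If $(A,C)$ is a graded algebraic quasi-Cartan pair, then $G_\star$ is Hausdorff.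
   Context: **Graded algebras and normalisers.** $A=\bigoplus_\gamma A_\gamma$ with $A_\gamma$ $R$-submodules, $A_\gamma A_\lambda\subseteq A_{\gamma\lambda}$; $\deg(a)=\gamma$ for $a\in A_\gamma\setminus\{0\}$. Algebras need not be unital. A ring is indecomposable if its only idempotents are $0,1$. For a commutative subalgebra $C$ of an $R$-algebra $B$, $I(C)$ is the set of idempotents of $C$; $n\in B$ is a normaliser of $C$ in $B$ if there is $m\in B$ with $mnm=m$, $nmn=n$, $mCn\cup nCm\subseteq C$; $N_B(C)$ is the set of normalisers. $I(C)$ is a set of local units for $B$ if for each finite $F\subseteq B$ there is $e\in I(C)$ with $ea=a=ae$ for all $a\in F$. (WT): if $e\in I(C)\setminus\{0\}$, $t\in R$ and $te=0$, then $t=0$. $N_\star(C)=\bigcup_\gamma(N_A(C)\cap A_\gamma)$. Under the hypotheses, the element $m$ for $n\in N_\star(C)$ is unique, written $n^\dagger$, and $N_\star(C)$ is an inverse semigroup with inverse $n\mapsto n^\dagger$ and idempotents $I(C)$. **Pairs.** A conditional expectation $P:B\to C$ is $R$-linear with $P|_C=\mathrm{id}_C$ and $P(cbc')=cP(b)c'$; faithful if for each $b\ne0$ in $B$ there is $n\in N_B(C)$ with $P(nb)\ne0$; implemented by idempotents if for each $n\in N_B(C)$ there is $e\in I(C)$ with $P(n)=ne=en$. $(B,C)$ is an algebraic quasi-Cartan pair if $C$ satisfies (WT), $I(C)$ is a set of local units for $B$, $C=\mathrm{span}_RI(C)$, $B=\mathrm{span}_RN_B(C)$, and there is a faithful conditional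 expectation $B\to C$ implemented by idempotents. $(A,C)$ is a graded algebraic quasi-Cartan pair if $(A_\epsilon,C)$ is an algebraic quasi-Cartan pair and $N_\star(C)$ spans $A$. **Groupoids $\Sigma_\star$, $G_\star$.** Natural partial order: $m\le n\iff m=nm^\dagger m$. $U^\uparrow=\{m\in N_\star(C):\exists n\in U,\ n\le m\}$. A filter is $U\subseteq N_\star(C)\setminus\{0\}$ with $U=U^\uparrow$ such that any $m,n\in U$ have some $p\in U$ with $p\le m,n$; an ultrafilter is a maximal filter. $\Sigma_\star$ is the set of ultrafilters, a groupoid with $U^{-1}=\{n^\dagger:n\in U\}$; $(U,V)$ composable iff $mn\neq0$ for all $m\in U,n\in V$; $UV=\{mn:m\in U,n\in V\}^\uparrow$; $\Sigma_\star^{(0)}=\{U:U\cap I(C)\ne\emptyset\}$. Its topology has basis $\mathcal V_n=\{U:n\in U\}$, $n\in N_\star(C)$. For $t\in R^\times$, $tU=\{tm:m\in U\}\in\Sigma_\star$. $G_\star=\Sigma_\star/{\simeq}$ has the quotient topology and operations $q(U)^{-1}=q(U^{-1})$, $q(U)q(W)=q(UW)$ for $(U,W)$ composable. All elements of an ultrafilter $U$ have the same degree; $c_{\Sigma_\star}(U)=\deg(n)$ for any $n\in U$ and $c_{G_\star}(q(U))=c_{\Sigma_\star}(U)$. **Graded discrete $R$-twists.** An open bisection is an open set $B$ with $r(B),s(B)$ open and $r|_B,s|_B$ homeomorphisms onto their images; a topological groupoid is ample if it has a basis of compact open bisections. A discrete $R$-twist over an ample groupoid $G$ is a sequence $G^{(0)}\times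 R^\times\xrightarrow{i}\Sigma\xrightarrow{q}G$, with $R^\times$ discrete, $G^{(0)}\times R^\times$ the trivial group bundle, $\Sigma$ a topological groupoid with $\Sigma^{(0)}=i(G^{(0)}\times\{1\})$, and $i,q$ continuous groupoid homomorphisms restricting to homeomorphisms of unit spaces, such that: (DT1) $i(\{x\}\times R^\times)=q^{-1}(x)$ for $x\in G^{(0)}$, $i$ injective, $q$ surjective; (DT2) each $\alpha\in G$ has an open bisection $B_\alpha\ni\alpha$ and a continuous $P_\alpha:B_\alpha\to\Sigma$ with $q\circ P_\alpha=\mathrm{id}$ and $(\beta,t)\mapsto i(r(\beta),t)P_\alpha(\beta)$ a homeomorphism $B_\alpha\times R^\times\to q^{-1}(B_\alpha)$; (DT3) $i(r(\sigma),t)\sigma=\sigma i(s(\sigma),t)$. It is $\Gamma$-graded if equipped with continuous groupoid homomorphisms $c_\Sigma:\Sigma\to\Gamma$, $c_G:G\to\Gamma$ with $c_\Sigma=c_G\circ q$. *)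

(* Defs.v *)
From HB Require Import structures.
From mathcomp Require Import all_boot all_order all_algebra.
From mathcomp Require Import all_classical.
From mathcomp Require Import topology_theory.topology.

Set Implicit Arguments.
Unset Strict Implicit.
Unset Printing Implicit Defensive.

Import GRing.Theory.
Local Open Scope classical_set_scope.
Local Open Scope ring_scope.
Local Open Scope quotient_scope.

(* The product of A is the semigroup law [(a * b)%g]; no unit is assumed. *)
HB.mixin Record Lmodule_isNuAlgebra (R : pzRingType) A
    of GRing.Lmodule R A & Semigroup A := {
  nuMDl : forall a b c : A, ((a + b)%R * c)%g = ((a * c)%g + (b * c)%g)%R;
  nuMDr : forall a b c : A, (a * (b + c)%R)%g = ((a * b)%g + (a * c)%g)%R;
  nuZAl : forall (t : R) (a b : A), t *: (a * b)%g = ((t *: a)%R * b)%g;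
  nuZAr : forall (t : R) (a b : A), t *: (a * b)%g = (a * (t *: b)%R)%g }.

#[short(type="nuAlgType")]
HB.structure Definition NuAlgebra (R : pzRingType) :=
  { A of GRing.Lmodule R A & Semigroup A & Lmodule_isNuAlgebra R A }.

Definition indecomposable (R : pzRingType) : Prop :=
  forall e : R, e * e = e -> e = 0 \/ e = 1.

Section Algebra.
Variables (R : comUnitRingType) (A : nuAlgType R).
Implicit Types (B C S : set A).

Definition submodule S : Prop :=
  S 0 /\ forall (t : R) a b, S a -> S b -> S (t *: a + b).

Definition subalgebra S : Prop :=
  submodule S /\ forall a b, S a -> S b -> S (a * b)%g.

Definition commutative_on S : Prop :=
  forall a b, S a -> S b -> (a * b)%g = (b * a)%g.

Definition lin_span S : set A :=
  [set a | exists2 s : seq (R * A),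
    (forall p, p \in s -> S p.2) & a = \sum_(p <- s) p.1 *: p.2].

Definition idems C : set A := [set e | C e /\ (e * e)%g = e].

Definition normaliser_witness B C (n m : A) : Prop :=
  [/\ B m, (m * n * m)%g = m, (n * m * n)%g = n &
      forall c, C c -> C (m * c * n)%g /\ C (n * c * m)%g].

Definition normalisers B C : set A :=
  [set n | B n /\ exists m, normaliser_witness B C n m].

Definition local_units B (E : set A) : Prop :=
  forall F : set A, finite_set F -> F `<=` B ->
    exists2 e, E e & forall a, F a -> (e * a)%g = a /\ (a * e)%g = a.

Definition without_torsion C : Prop :=
  forall (e : A) (t : R), idems C e -> e != 0 -> t *: e = 0 -> t = 0.

(* P is a map B -> C, extended arbitrarily to A: only its values on B count. *)
Definition conditional_expectation B C (P : A -> A) : Prop :=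
  [/\ forall b, B b -> C (P b),
      forall (t : R) b b', B b -> B b' -> P (t *: b + b') = t *: P b + P b',
      forall c, C c -> P c = c &
      forall c b c', C c -> B b -> C c' -> P (c * b * c')%g = (c * P b * c')%g].

Definition faithful_expectation B C (P : A -> A) : Prop :=
  forall b, B b -> b != 0 -> exists2 n, normalisers B C n & P (n * b)%g != 0.

Definition implemented_by_idempotents B C (P : A -> A) : Prop :=
  forall n, normalisers B C n ->
    exists2 e, idems C e & P n = (n * e)%g /\ (n * e)%g = (e * n)%g.

Definition algebraic_quasi_Cartan_pair B C : Prop :=
  [/\ without_torsion C, local_units B (idems C), C = lin_span (idems C),
      B = lin_span (normalisers B C) &
      exists P : A -> A, [/\ conditional_expectation B C P,
        faithful_expectation B C P & implemented_by_idempotents B C P]].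

Variable Gamma : groupType.

(* [\sum_(g \in setT) f g] is the sum of a finitely supported family. *)
Definition is_grading (D : Gamma -> set A) : Prop :=
  [/\ forall g, submodule (D g),
      forall g h a b, D g a -> D h b -> D (g * h)%g (a * b)%g &
      forall a, exists! f : Gamma -> A,
        [/\ forall g, D g (f g), finite_set [set g | f g != 0] &
            \sum_(g \in [set: Gamma]) f g = a]].

End Algebra.

(* [gmul g h] is meaningful only when [gcomp g h]. *)
Record groupoid_ops (G : Type) := GroupoidOps {
  gcomp : G -> G -> Prop;
  gmul : G -> G -> G;
  ginv : G -> G }.

Section Groupoids.
Variables (G : Type) (o : groupoid_ops G).

Definition is_groupoid : Prop :=
  [/\ forall g, ginv o (ginv o g) = g,
      forall g h k, gcomp o g h -> gcomp o h k ->
        [/\ gcomp o (gmul o g h) k, gcomp o g (gmul o h k) &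
            gmul o (gmul o g h) k = gmul o g (gmul o h k)],
      forall g, gcomp o (ginv o g) g /\ gcomp o g (ginv o g),
      forall g h, gcomp o g h -> gmul o (ginv o g) (gmul o g h) = h &
      forall g h, gcomp o h g -> gmul o (gmul o h g) (ginv o g) = h].

Definition rng (g : G) : G := gmul o g (ginv o g).
Definition src (g : G) : G := gmul o (ginv o g) g.
Definition unit_space : set G := range rng.

Lemma rng_unit_space g : rng g \in unit_space.
Proof. by apply/mem_set; exists g. Qed.

Definition rng0 (g : G) : set_type unit_space := exist _ (rng g) (rng_unit_space g).

End Groupoids.

Definition groupoid_hom (G H : Type) (oG : groupoid_ops G)
    (oH : groupoid_ops H) (f : G -> H) : Prop :=
  forall g h, gcomp oG g h ->
    gcomp oH (f g) (f h) /\ f (gmul oG g h) = gmul oH (f g) (f h).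

Definition group_groupoid (Gamma : groupType) : groupoid_ops Gamma :=
  GroupoidOps (fun _ _ => True) (fun g h => (g * h)%g) (fun g => g^-1%g).

(* f restricts to a homeomorphism from A onto B, for the subspace topologies;
   the last clause says that f is relatively open from A to B. *)
Definition homeo_on (X Y : topologicalType) (A : set X) (B : set Y)
    (f : X -> Y) : Prop :=
  [/\ set_bij A B f, {within A, continuous f} &
      forall O : set X, open O ->
        exists2 O' : set Y, open O' & f @` (A `&` O) = B `&` O'].

Section TopologicalGroupoids.
Variables (G : topologicalType) (o : groupoid_ops G).

Definition topological_groupoid : Prop :=
  [/\ is_groupoid o, continuous (ginv o) &
      {within [set p : G * G | gcomp o p.1 p.2],
        continuous (fun p : G * G => gmul o p.1 p.2)}].

Definition open_bisection (B : set G) : Prop :=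
  [/\ open B, open (rng o @` B), open (src o @` B),
      homeo_on B (rng o @` B) (rng o) & homeo_on B (src o @` B) (src o)].

Definition ample_groupoid : Prop :=
  topological_groupoid /\
  forall (O : set G) (g : G), open O -> O g ->
    exists B, [/\ compact B, open_bisection B, B g & B `<=` O].

End TopologicalGroupoids.

Section Units.
Variable R : comUnitRingType.

Definition Runits : Type := discrete_topology {t : R | t \is a GRing.unit}.
HB.instance Definition _ := DiscreteTopology.on Runits.

Lemma RunitM_subproof (s t : Runits) : sval s * sval t \is a GRing.unit.
Proof. by rewrite unitrM (svalP s) (svalP t). Qed.

Lemma RunitV_subproof (t : Runits) : (sval t)^-1 \is a GRing.unit.
Proof. by rewrite unitrV (svalP t). Qed.

Let is_unit (t : R) : Prop := t \is a GRing.unit.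
Definition Runit1 : Runits := exist is_unit 1 (unitr1 R).
Definition RunitM (s t : Runits) : Runits :=
  exist is_unit (sval s * sval t) (RunitM_subproof s t).
Definition RunitV (t : Runits) : Runits :=
  exist is_unit (sval t)^-1 (RunitV_subproof t).

Definition trivial_bundle (X : Type) : groupoid_ops (X * Runits) :=
  GroupoidOps (fun p p' => p.1 = p'.1)
    (fun p p' => (p.1, RunitM p.2 p'.2)) (fun p => (p.1, RunitV p.2)).

End Units.

Section Twists.
Variables (R : comUnitRingType) (Sigma G : topologicalType).
Variables (oS : groupoid_ops Sigma) (oG : groupoid_ops G).
Variables (i : set_type (unit_space oG) * Runits R -> Sigma) (q : Sigma -> G).

Definition DT1 : Prop :=
  [/\ forall x, [set i (x, t) | t in [set: Runits R]] = q @^-1` [set set_val x],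
      injective i & forall g, exists U, q U = g].

Definition DT2 : Prop :=
  forall a : G, exists B : set G, exists P : G -> Sigma,
    [/\ open_bisection oG B, B a, {within B, continuous P},
        forall b, B b -> q (P b) = b &
        homeo_on (B `*` [set: Runits R]) (q @^-1` B)
          (fun p : G * Runits R => gmul oS (i (rng0 oG p.1, p.2)) (P p.1))].

(* The unit r(U) of Sigma is identified, through q, with the unit q(r(U)) =
   r(q(U)) of G; likewise for s(U) = r(U^-1). *)
Definition DT3 : Prop :=
  forall (U : Sigma) (t : Runits R),
    gmul oS (i (rng0 oG (q U), t)) U =
    gmul oS U (i (rng0 oG (q (ginv oS U)), t)).

Definition discrete_twist : Prop :=
  [/\ ample_groupoid oG, topological_groupoid oS &
      unit_space oS = i @` [set p | p.2 = Runit1 R]] /\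
  [/\ continuous i, groupoid_hom (trivial_bundle R (set_type (unit_space oG))) oS i &
      homeo_on [set p | p.2 = Runit1 R] (unit_space oS) i] /\
  [/\ continuous q, groupoid_hom oS oG q &
      homeo_on (unit_space oS) (unit_space oG) q] /\
  [/\ DT1, DT2 & DT3].

Definition graded_discrete_twist (Gamma : groupType)
    (cS : Sigma -> Gamma) (cG : G -> Gamma) : Prop :=
  discrete_twist /\
  [/\ continuous (cS : Sigma -> discrete_topology Gamma),
      continuous (cG : G -> discrete_topology Gamma),
      groupoid_hom oS (group_groupoid Gamma) cS,
      groupoid_hom oG (group_groupoid Gamma) cG &
      cS = cG \o q].

End Twists.

Section Ultrafilters.
Variables (R : comUnitRingType) (A : nuAlgType R) (Gamma : groupType).
Variables (D : Gamma -> set A) (C : set A).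

Definition Nstar : set A :=
  [set n | normalisers setT C n /\ exists g, D g n].

Definition graded_algebraic_quasi_Cartan_pair : Prop :=
  algebraic_quasi_Cartan_pair (D 1%g) C /\ lin_span Nstar = setT.

Definition dagger (n : A) : A := xget 0 [set m | normaliser_witness setT C n m].

Definition nle (m n : A) : Prop := m = (n * dagger m * m)%g.

Definition upset (U : set A) : set A :=
  [set m | Nstar m /\ exists2 n, U n & nle n m].

(* Filters are nonempty; this only matters when Nstar = {0}. *)
Definition nfilter (U : set A) : Prop :=
  [/\ U !=set0, U `<=` Nstar `\ 0, U = upset U &
      forall m n, U m -> U n -> exists p, [/\ U p, nle p m & nle p n]].

Definition nultrafilter (U : set A) : Prop :=
  nfilter U /\ forall W, nfilter W -> U `<=` W -> W = U.

Definition Sigma_star : Type := {U : set A | `[< nultrafilter U >]}.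

HB.instance Definition _ := SubType.on Sigma_star.
HB.instance Definition _ := Choice.on Sigma_star.

Definition basic_open (n : A) : set Sigma_star := [set U | val U n].

Lemma basic_open_cover : \bigcup_(n in Nstar) basic_open n = setT.
Proof.
apply/seteqP; split=> // -[U uU] _.
have [[[n Un] /(_ _ Un)[Nn _] _ _] _] := asboolP _ uU.
by exists n.
Qed.

Lemma basic_open_join (m n : A) (U : Sigma_star) :
  Nstar m -> Nstar n -> basic_open m U -> basic_open n U ->
  exists k, [/\ Nstar k, basic_open k U &
    basic_open k `<=` basic_open m `&` basic_open n].
Proof.
case: U => U uU Nm Nn; rewrite /basic_open /= => Um Un.
have [[_ UN _ Ud] _] := asboolP _ uU.
have [p [Up pm pn]] := Ud _ _ Um Un.
exists p; split=> //; first by have [] := UN _ Up.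
move=> [V uV] /= Vp; have [[_ _ Vup _] _] := asboolP _ uV.
by split; rewrite /= Vup; split=> //; exists p.
Qed.

(* [isBaseTopological] wants the index type of the basis to be pointed. *)
Let index : Type := A.
HB.instance Definition _ := Choice.on index.
HB.instance Definition _ := isPointed.Build index 0.

HB.instance Definition _ :=
  @isBaseTopological.Build Sigma_star index Nstar basic_open
    basic_open_cover basic_open_join.

Definition set_inverse (U : set A) : set A := dagger @` U.
Definition set_product (U V : set A) : set A :=
  upset [set (p.1 * p.2)%g | p in U `*` V].
Definition set_scale (t : Runits R) (U : set A) : set A :=
  [set sval t *: m | m in U].

(* [insubd U S] is the ultrafilter S, or the junk value U if S is not one;
   [star_operations_well_defined] asserts that the junk value never occurs. *)
Definition Sigma_star_groupoid : groupoid_ops Sigma_star :=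
  GroupoidOps
    (fun U V => forall m n, val U m -> val V n -> (m * n)%g != 0)
    (fun U V => insubd U (set_product (val U) (val V)))
    (fun U => insubd U (set_inverse (val U))).

Definition Sigma_star_scale (t : Runits R) (U : Sigma_star) : Sigma_star :=
  insubd U (set_scale t (val U)).

Definition Sigma_star_units : set Sigma_star :=
  [set U | val U `&` idems C !=set0].

Definition Sigma_star_degree (U : Sigma_star) : Gamma :=
  xget 1%g [set g | exists2 n, val U n & D g n].

Definition unit_equiv (U W : Sigma_star) : bool :=
  `[< exists t : Runits R, val U = set_scale t (val W) >].

Lemma set_scale1 U : set_scale (Runit1 R) U = U.
Proof.
by apply/seteqP; split=> [_ [m Um <-]|m Um];
  rewrite /= ?scale1r //; exists m; rewrite ?scale1r.
Qed.

Lemma set_scaleM s t U : set_scale s (set_scale t U) = set_scale (RunitM s t) U.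
Proof.
apply/seteqP; split=> [_ [_ [m Um <-] <-]|_ [m Um <-]].
  by exists m; rewrite //= scalerA.
by exists (sval t *: m); [exists m|rewrite /= scalerA].
Qed.

Lemma set_scaleK t U : set_scale (RunitV t) (set_scale t U) = U.
Proof.
rewrite set_scaleM -[RHS]set_scale1; congr set_scale.
by apply: val_inj; rewrite /= mulVr // (svalP t).
Qed.

Lemma unit_equiv_refl : reflexive unit_equiv.
Proof. by move=> U; apply/asboolP; exists (Runit1 R); rewrite set_scale1. Qed.

Lemma unit_equiv_sym : symmetric unit_equiv.
Proof.
move=> U W; apply/idP/idP => /asboolP[t e]; apply/asboolP;
by exists (RunitV t); rewrite e set_scaleK.
Qed.

Lemma unit_equiv_trans : transitive unit_equiv.
Proof.
move=> V U W /asboolP[s es] /asboolP[t et]; apply/asboolP.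
by exists (RunitM s t); rewrite es et set_scaleM.
Qed.

Definition unit_equiv_rel : equiv_rel Sigma_star :=
  EquivRel unit_equiv unit_equiv_refl unit_equiv_sym unit_equiv_trans.

Definition G_star : Type := quotient_topology {eq_quot unit_equiv_rel}.

HB.instance Definition _ := Quotient.on G_star.
HB.instance Definition _ := Topological.on G_star.

Definition q_star (U : Sigma_star) : G_star := \pi_G_star U.

(* Operations on classes are computed on the representatives chosen by [repr]. *)
Definition G_star_groupoid : groupoid_ops G_star :=
  GroupoidOps
    (fun x y => exists U V, [/\ q_star U = x, q_star V = y &
                               gcomp Sigma_star_groupoid U V])
    (fun x y => q_star (gmul Sigma_star_groupoid (repr x) (repr y)))
    (fun x => q_star (ginv Sigma_star_groupoid (repr x))).

Definition G_star_degree (x : G_star) : Gamma := Sigma_star_degree (repr x).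

Definition i_star (p : set_type (unit_space G_star_groupoid) * Runits R)
    : Sigma_star :=
  Sigma_star_scale p.2
    (xget (repr (set_val p.1 : G_star))
       [set U | Sigma_star_units U /\ q_star U = set_val p.1]).

(* The operations satisfy their defining formulas, so that neither the defaults
   of [insubd] and [xget] nor the choice of representatives matters. *)
Definition star_operations_well_defined : Prop :=
  [/\ forall U, val (ginv Sigma_star_groupoid U) = set_inverse (val U),
      forall U V, gcomp Sigma_star_groupoid U V ->
        val (gmul Sigma_star_groupoid U V) = set_product (val U) (val V),
      unit_space Sigma_star_groupoid = Sigma_star_units,
      forall t U, val (Sigma_star_scale t U) = set_scale t (val U) &
      forall (U : Sigma_star) n g, val U n -> D g n -> Sigma_star_degree U = g] /\
  [/\ forall U, ginv G_star_groupoid (q_star U) =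
        q_star (ginv Sigma_star_groupoid U),
      forall U V, gcomp Sigma_star_groupoid U V ->
        gmul G_star_groupoid (q_star U) (q_star V) =
        q_star (gmul Sigma_star_groupoid U V),
      unit_space G_star_groupoid = q_star @` Sigma_star_units,
      forall (x : set_type (unit_space G_star_groupoid)) U t,
        Sigma_star_units U -> q_star U = set_val x ->
        i_star (x, t) = Sigma_star_scale t U &
      forall U, G_star_degree (q_star U) = Sigma_star_degree U].

End Ultrafilters.

(* Main.v *)
Require Import Defs.
From mathcomp Require Import all_boot all_order all_algebra.
From mathcomp Require Import all_classical.
From mathcomp Require Import topology_theory.topology.

Set Implicit Arguments.
Unset Strict Implicit.
Unset Printing Implicit Defensive.

Import GRing.Theory.
Local Open Scope classical_set_scope.
Local Open Scope ring_scope.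

(** The proof replaces an ultrafilter [U] of the inverse semigroup [Nstar D
    C] by a germ. Write [E] for the commuting idempotents [idems C]. The
    source of [U] is the filter of those [e] in [E] that fix some member of
    [U] on the right, and [U] is recovered from its source [F] and any one
    member [u]: it consists of the [m] that agree with [u] after being cut
    by an idempotent in [F] ([nfilter_germ]). Moreover [U] is an ultrafilter
    exactly when [F] is an ultrafilter of the generalised Boolean algebra
    [E] ([eultrafilter_src], [nultrafilter_germ]), that is, when every
    idempotent lies in [F] or is disjoint from a member of [F]. Two
    ultrafilters with the same source and a common member are therefore
    equal ([ultra_eq]), [U] and [V] are composable exactly when the source
    of [U] is the range of [V] ([compP]), and each groupoid identity is
    checked by exhibiting one common member.

    All this rests on [Nstar D C] being an inverse semigroup with
    idempotents in [C], although [A] has only local identity elements, and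
    only in degree one ([homogeneous_witness]).

    For the topology, the basic open sets of [Sigma_star] are compact, as in
    Stone duality for [E] ([compact_basic]), and the quotient map [q] is
    open. Absence of torsion makes the units of [R] act freely on
    [Sigma_star]; more precisely, an orbit meets each basic open set, and
    the set of units, in at most one point ([scale_free], [units_scale]).
    Hence [q] is injective on basic open sets and on the units, the images
    of basic open sets are compact open bisections of [G_star] ([G_ample]),
    and [q] has continuous local sections. The inclusion [i] and the local
    trivialisations both have the form [(x, t) |-> t *: s x] for such a
    section [s], and maps of this form are homeomorphisms onto their open
    images ([scaled_homeo]).

    For the Hausdorff property, let [q U] and [q V] have no disjoint
    neighbourhoods. Then [U] and [V] have the same source and degree, so
    that [U V^-1] has a member [k = n ** dag m] of degree one, and [P k = k
    ** e] with [e] idempotent. If [e] is in the source, then [U V^-1]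
    contains a multiple [t *: f] of an idempotent; [t] is a unit because [R]
    is indecomposable ([scalar_member_unit]), and [U = t V]. Otherwise an
    idempotent of the source disjoint from [e] cuts [k] down to an element
    killed by [P], and [expectation_separates] gives disjoint
    neighbourhoods. *)

Local Arguments gmul : simpl never.
Local Arguments ginv : simpl never.
Local Notation "x ** y" := (x * y)%g (at level 40, left associativity).

(** * Preliminaries *)

(** Every homeomorphism below is an injective continuous map that is open on
    its domain. *)
Lemma homeo_on_open (X Y : topologicalType) (B : set X) (f : X -> Y) :
    {within B, continuous f} -> {in B &, injective f} ->
    (forall O, open O -> open (f @` (B `&` O))) ->
  homeo_on B (f @` B) f.
Proof.
move=> cf injf openf; split=> //; first by split.
move=> O oO; exists (f @` (B `&` O)); first exact: openf.
apply/esym/setIidr => _ [x [Bx _] <-]; exact: imageP.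
Qed.

Section NonUnitalAlgebra.
Variables (R : comUnitRingType) (A : nuAlgType R).
Implicit Types (a b c d e x : A).

Lemma nu_mul0l a : 0 ** a = 0 :> A.
Proof. by rewrite -[X in X ** a](scale0r (0 : A)) -nuZAl scale0r. Qed.

Lemma nu_mul0r a : a ** 0 = 0 :> A.
Proof. by rewrite -[X in a ** X](scale0r (0 : A)) -nuZAr scale0r. Qed.

Lemma nu_mulBl a b c : (a - b) ** c = a ** c - b ** c.
Proof. by rewrite nuMDl -scaleN1r -nuZAl scaleN1r. Qed.

Lemma nu_mulBr a b c : a ** (b - c) = a ** b - a ** c.
Proof. by rewrite nuMDr -scaleN1r -nuZAr scaleN1r. Qed.

(** In a left-associated product an identity between products applies only at
    the head; this lemma and the next move it under a prefix. *)
Lemma under_mul3 a b c d x : a ** b ** c = d -> x ** a ** b ** c = x ** d.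
Proof. by move=> <-; rewrite !mulgA. Qed.

Lemma under_mul4 a b c d e x :
  a ** b ** c ** d = e -> x ** a ** b ** c ** d = x ** e.
Proof. by move=> <-; rewrite !mulgA. Qed.

Section Grading.
Variables (Gamma : groupType) (D : Gamma -> set A).
Hypothesis gradA : is_grading D.

Lemma graded_unique_decomposition k a f : D k a ->
    [/\ forall h, D h (f h), finite_set [set h | f h != 0] &
        (\sum_(h \in [set: Gamma]) f h)%R = a] ->
  f = fun h => if h == k then a else 0.
Proof.
move=> Dka fdec; case: gradA => sub0 _ dec.
have D0 h : D h 0 by have [] := sub0 h.
have [f0 [_ uf0]] := dec a; rewrite -(uf0 _ fdec); apply: uf0; split.
- by move=> h; case: eqP => [->|].
- apply: sub_finite_set (finite_set1 k) => h /=.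
  by case: (h =P k) => // _; rewrite eqxx.
- rewrite -(fsbig_widen [set k]) ?fsbig_set1 ?eqxx // => h [_ /eqP/negPf].
  by move=> /= ->.
Qed.

(** An additive map that moves degrees by a bijection [sigma] commutes with
    taking homogeneous components, because components are unique. *)
Lemma graded_component (phi : A -> A) (sigma tau : Gamma -> Gamma) a g :
    phi 0 = 0 -> {morph phi : x y / (x + y)%R} -> cancel sigma tau ->
    cancel tau sigma -> (forall h x, D h x -> D (sigma h) (phi x)) ->
    D g (phi a) ->
  exists2 b, D (tau g) b & phi b = phi a.
Proof.
move=> phi0 phiD sK tK Dphi Dga; case: gradA => _ _ dec.
have [f [[fD finf sumf] _]] := dec a.
exists (f (tau g)) => //.
have fE : (fun h => phi (f (tau h))) = fun h => if h == g then phi a else 0.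
  apply: graded_unique_decomposition => //; split.
  - by move=> h; rewrite -[h in D h]tK; exact/Dphi/fD.
  - apply: sub_finite_set (finite_image sigma finf) => h /= nz.
    by exists (tau h) => //=; apply: contra_neq nz => ->.
  - rewrite (@reindex_fsbigT _ _ _ _ _ sigma (fun h => phi (f (tau h))));
      last by exists tau.
    rewrite -sumf.
    rewrite (fsbigTE (fset_set [set g0 | f g0 != 0])); last first.
      move=> h; rewrite in_fset_set // notin_setE /= sK => /negP.
      by rewrite negbK => /eqP ->.
    rewrite (fsbigTE (fset_set [set g0 | f g0 != 0])); last first.
      move=> h; rewrite in_fset_set // notin_setE /= => /negP.
      by rewrite negbK => /eqP ->.
    rewrite (big_morph phi phiD phi0).
    by apply: eq_bigr => h _; rewrite sK.
by have := congr1 (@^~ g) fE; rewrite eqxx.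
Qed.

Lemma graded_disjoint g h a : D g a -> D h a -> a != 0 -> g = h.
Proof.
move=> Dga Dha a0; have [_ _ dec] := gradA; have [f [fdec _]] := dec a.
have := congr1 (@^~ g) (graded_unique_decomposition Dga fdec).
rewrite (graded_unique_decomposition Dha fdec) eqxx.
by case: eqP => // _ /esym/eqP; rewrite (negPf a0).
Qed.

End Grading.
End NonUnitalAlgebra.

(** * The inverse semigroup of homogeneous normalisers *)

Section GradedPair.
Variables (R : comUnitRingType) (Gamma : groupType) (A : nuAlgType R).
Variables (D : Gamma -> set A) (C : set A).
Hypotheses (gradA : is_grading D) (subC : subalgebra C).
Hypotheses (comC : commutative_on C) (C_deg1 : C `<=` D 1%g).
Hypothesis (luC : local_units (D 1%g) (idems C)).

Local Notation N := (Nstar D C).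
Local Notation E := (idems C).
Local Notation dag := (dagger C).
Local Notation "m '<=N' n" := (nle C m n) (at level 70).

Implicit Types (a b c e f k m n p u v : A) (g h : Gamma) (t : R).

Lemma D_mul g h a b : D g a -> D h b -> D (g * h)%g (a ** b).
Proof. by case: gradA => _ DM _; exact: DM. Qed.

Lemma D_scale g t a : D g a -> D g (t *: a).
Proof.
move=> Da; have [subD _ _] := gradA; have [D0 DL] := subD g.
by rewrite -[_ *: _]addr0; apply: DL.
Qed.

Lemma C_mul a b : C a -> C b -> C (a ** b).
Proof. by case: subC => _; apply. Qed.

Lemma C0 : C 0. Proof. by case: subC => -[]. Qed.

Lemma C_lin t a b : C a -> C b -> C (t *: a + b).
Proof. by case: subC => -[_ +] _; apply. Qed.

Lemma C_scale t a : C a -> C (t *: a).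
Proof. by move=> Ca; rewrite -[_ *: _]addr0; exact: C_lin Ca C0. Qed.

Lemma C_sub a b : C a -> C b -> C (a - b).
Proof. by move=> Ca Cb; rewrite addrC -scaleN1r; exact: C_lin. Qed.

Lemma E_C e : E e -> C e. Proof. by case. Qed.
Lemma E_idem e : E e -> e ** e = e. Proof. by case. Qed.

Lemma E_comm e f : E e -> E f -> e ** f = f ** e.
Proof. by case=> Ce _ [Cf _]; exact: comC. Qed.

Lemma E_mul e f : E e -> E f -> E (e ** f).
Proof.
move=> Ee Ef; split; first by apply: C_mul; exact: E_C.
by rewrite -mulgA [f ** _]mulgA (E_comm Ef Ee) -mulgA (E_idem Ef) mulgA (E_idem
  Ee).
Qed.

Lemma mulEE a e : E e -> a ** e ** e = a ** e.
Proof. by move=> Ee; rewrite -mulgA E_idem. Qed.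

Lemma mulE_AC a e f : E e -> E f -> a ** e ** f = a ** f ** e.
Proof. by move=> Ee Ef; rewrite -mulgA (E_comm Ee Ef) mulgA. Qed.

Lemma E0 : E 0. Proof. by split; [exact: C0 | rewrite nu_mul0l]. Qed.

Lemma E_sub e f : E e -> E f -> E (e - e ** f).
Proof.
move=> Ee Ef; have Eef := E_mul Ee Ef; split.
  by apply: C_sub; exact: E_C.
rewrite nu_mulBl !nu_mulBr (E_idem Ee) (E_idem Eef) (mulgA e e) (E_idem Ee).
by rewrite (E_comm Eef Ee) (mulgA e e) (E_idem Ee) subrr subr0.
Qed.

(** Only the component [m'] of [m] in degree [g^-1] matters for
    [n ** m ** n = n]. A local unit for the degree-one elements [n ** m'] and
    [m' ** n] then fixes [n] on both sides, which puts [m ** n] and [n ** m] in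
    [C], and [m = (m ** n) ** m' ** (n ** m)] has degree [g^-1]. *)
Lemma homogeneous_witness g n m : D g n -> normaliser_witness setT C n m ->
  [/\ C (m ** n), C (n ** m) & D g^-1%g m].
Proof.
move=> Dn [_ mnm nmn mC].
have [m' Dm' nm'n] : exists2 m', D (g^-1 * g * g^-1)%g m' &
    n ** m' ** n = n ** m ** n.
  apply: (graded_component gradA (phi := fun x => n ** x ** n)
    (sigma := fun h => (g * h * g)%g) (tau :=
      fun h => (g^-1 * h * g^-1)%g)) => //.
  - by rewrite nu_mul0r nu_mul0l.
  - by move=> x y; rewrite nuMDr nuMDl.
  - by move=> h; rewrite !mulgA mulVg mul1g -mulgA mulgV mulg1.
  - by move=> h; rewrite !mulgA mulgV mul1g -mulgA mulVg mulg1.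
  - by move=> h x Dx; apply: D_mul => //; exact: D_mul.
  - by rewrite nmn.
rewrite mulVg mul1g in Dm'; rewrite nmn in nm'n.
have Dnm : D 1%g (n ** m') by rewrite -(mulgV g); exact: D_mul.
have Dmn : D 1%g (m' ** n) by rewrite -(mulVg g); exact: D_mul.
have [||e Ee eU] := luC (F := [set n ** m'; m' ** n]).
- by [].
- by move=> _ [->|->].
have [eL _] := eU _ (or_introl erefl); have [_ eR] := eU _ (or_intror erefl).
have en : e ** n = n by rewrite -[in LHS]nm'n mulgA eL nm'n.
have ne : n ** e = n by rewrite -[in LHS]nm'n -(mulgA n) -mulgA eR mulgA nm'n.
have Cmn : C (m ** n) by rewrite -en mulgA; apply: (mC _ (E_C Ee)).1.
have Cnm : C (n ** m) by rewrite -ne; apply: (mC _ (E_C Ee)).2.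
split => //.
have Dm1 : D 1%g (m ** n) by exact: C_deg1.
have Dn1 : D 1%g (n ** m) by exact: C_deg1.
have -> : m = (m ** n) ** m' ** (n ** m).
  by rewrite mulgA -(mulgA m n m') -(mulgA m) nm'n mnm.
by rewrite -[g^-1%g]mul1g -[(1 * g^-1)%g]mulg1; apply: D_mul => //;
  exact: D_mul.
Qed.

Lemma witness_sym n m : normaliser_witness setT C n m ->
  normaliser_witness setT C m n.
Proof. by case=> _ mnm nmn mC; split=> // c /mC[]. Qed.

(** The usual argument for uniqueness of inverses when idempotents commute: both
    [m] and [m'] equal [m' ** n ** m]. *)
Lemma witness_unique g n m m' : D g n ->
  normaliser_witness setT C n m -> normaliser_witness setT C n m' -> m = m'.
Proof.
move=> Dn wm wm'.
have [Cmn Cnm _] := homogeneous_witness Dn wm.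
have [Cmn' Cnm' _] := homogeneous_witness Dn wm'.
have [_ mnm nmn _] := wm; have [_ mnm' nmn' _] := wm'.
have comm1 : m ** n ** m' ** n = m' ** n ** m ** n.
  by have := comC Cmn Cmn'; rewrite !mulgA.
have comm2 : n ** m' ** n ** m = n ** m ** n ** m'.
  by have := comC Cnm' Cnm; rewrite !mulgA.
transitivity (m' ** n ** m).
  by rewrite -[X in m' ** n ** X]mnm !mulgA -comm1 (under_mul3 _ nmn') mnm.
by rewrite -[X in X ** n ** m]mnm' (under_mul4 _ comm2) !mulgA (under_mul3 _
  nmn) mnm'.
Qed.

Lemma N_dagP n : N n -> normaliser_witness setT C n (dag n).
Proof. by case=> -[_ nw] _; exact: xgetPex nw. Qed.

Lemma dag_unique n m : N n -> normaliser_witness setT C n m -> dag n = m.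
Proof.
by move=> Nn wm; have [_ [g Dn]] := Nn; exact: witness_unique Dn (N_dagP Nn) wm.
Qed.

Lemma N_witness g n m : D g n -> normaliser_witness setT C n m -> N n.
Proof. by move=> Dn wm; split; [split=> //; exists m | exists g]. Qed.

Lemma mulNdN n : N n -> n ** dag n ** n = n.
Proof. by case/N_dagP. Qed.

Lemma muldNd n : N n -> dag n ** n ** dag n = dag n.
Proof. by case/N_dagP. Qed.

Lemma D_dag g n : N n -> D g n -> D g^-1%g (dag n).
Proof. by move=> Nn Dn; have [] := homogeneous_witness Dn (N_dagP Nn). Qed.

Lemma N_dag n : N n -> N (dag n).
Proof.
move=> Nn; have [_ [g Dn]] := Nn.
exact: N_witness (D_dag Nn Dn) (witness_sym (N_dagP Nn)).
Qed.

Lemma dagK n : N n -> dag (dag n) = n.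
Proof. by move=> Nn; apply: dag_unique (N_dag Nn) (witness_sym (N_dagP Nn)).
  Qed.

Lemma E_dagN n : N n -> E (dag n ** n).
Proof.
move=> Nn; have [_ [g Dn]] := Nn.
have [Cdn _ _] := homogeneous_witness Dn (N_dagP Nn).
by split=> //; rewrite mulgA muldNd.
Qed.

Lemma E_Ndag n : N n -> E (n ** dag n).
Proof. by move=> Nn; rewrite -[X in X ** _]dagK //; exact/E_dagN/N_dag. Qed.

Lemma witness_E e : E e -> normaliser_witness setT C e e.
Proof.
move=> Ee; split; rewrite ?E_idem //.
by move=> c Cc; split; apply: C_mul => //; try apply: C_mul => //; exact: E_C.
Qed.

Lemma N_E e : E e -> N e.
Proof. by move=> Ee; exact: N_witness (C_deg1 (E_C Ee)) (witness_E Ee). Qed.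

Lemma dag_E e : E e -> dag e = e.
Proof. by move=> Ee; exact: dag_unique (N_E Ee) (witness_E Ee). Qed.

Lemma E_dagN_comm n e : N n -> E e -> dag n ** n ** e = e ** dag n ** n.
Proof. by move=> Nn Ee; rewrite (E_comm (E_dagN Nn) Ee) mulgA. Qed.

Lemma E_Ndag_comm n e : N n -> E e -> n ** dag n ** e = e ** n ** dag n.
Proof. by move=> Nn Ee; rewrite (E_comm (E_Ndag Nn) Ee) mulgA. Qed.

Lemma E_conj n e : N n -> E e -> E (n ** e ** dag n).
Proof.
move=> Nn Ee; have [_ _ _ nC] := N_dagP Nn.
split; first by have [] := nC _ (E_C Ee).
rewrite !mulgA (under_mul3 n (esym (E_dagN_comm Nn Ee))) !mulgA mulNdN //.
by rewrite -(mulgA n e e) E_idem.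
Qed.

(** Idempotents can be moved across a normaliser: [n ** e ** dag n] is the
    idempotent that acts on the left of [n] as [e] does on the right. *)
Lemma mulNE n e : N n -> E e -> n ** e = n ** e ** dag n ** n.
Proof.
by move=> Nn Ee; rewrite (under_mul3 _ (esym (E_dagN_comm Nn Ee))) !mulgA
  mulNdN.
Qed.

Lemma mulEN n e : N n -> E e -> e ** n = n ** (dag n ** e ** n).
Proof.
by move=> Nn Ee; rewrite !mulgA (E_Ndag_comm Nn Ee) -!mulgA (mulgA n) mulNdN.
Qed.

(** The product of the inverses is an inverse because the idempotents
    [dag m ** m] and [n ** dag n] in the middle commute. *)
Lemma witness_mul m n : N m -> N n ->
  normaliser_witness setT C (m ** n) (dag n ** dag m).
Proof.
move=> Nm Nn; have [_ _ _ mC] := N_dagP Nm; have [_ _ _ nC] := N_dagP Nn.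
have comm4 : dag m ** m ** n ** dag n = n ** dag n ** dag m ** m.
  by have := E_comm (E_dagN Nm) (E_Ndag Nn); rewrite !mulgA.
split => //.
- rewrite !mulgA (under_mul4 _ comm4) !mulgA (muldNd Nn).
  by rewrite (under_mul3 _ (muldNd Nm)).
- rewrite !mulgA (under_mul4 _ (esym comm4)) !mulgA (mulNdN Nm).
  by rewrite (under_mul3 _ (mulNdN Nn)).
- move=> c Cc; split.
  + rewrite -!mulgA (mulgA (dag m)) (mulgA (dag m ** c)) mulgA.
    by apply: (nC _ _).1; apply: (mC _ _).1.
  + rewrite -!mulgA (mulgA n) (mulgA (n ** c)) mulgA.
    by apply: (mC _ _).2; apply: (nC _ _).2.
Qed.

Lemma N_mul m n : N m -> N n -> N (m ** n).
Proof.
move=> Nm Nn; have [_ [g Dm]] := Nm; have [_ [h Dn]] := Nn.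
exact: N_witness (D_mul Dm Dn) (witness_mul Nm Nn).
Qed.

Lemma dag_mul m n : N m -> N n -> dag (m ** n) = dag n ** dag m.
Proof. by move=> Nm Nn;
  exact: dag_unique (N_mul Nm Nn) (witness_mul Nm Nn). Qed.

Lemma witness_scale t n : t \is a GRing.unit -> N n ->
  normaliser_witness setT C (t *: n) (t^-1 *: dag n).
Proof.
move=> tU Nn; have [_ _ _ nC] := N_dagP Nn; split=> //.
- by rewrite -!(nuZAl, nuZAr) !scalerA muldNd // divrK.
- by rewrite -!(nuZAl, nuZAr) !scalerA mulNdN // -mulrA divrr // mulr1.
- move=> c /nC[]; rewrite -!(nuZAl, nuZAr) !scalerA mulVr // divrr // !scale1r.
  by [].
Qed.

Lemma N_scale t n : t \is a GRing.unit -> N n -> N (t *: n).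
Proof.
move=> tU Nn; have [_ [g Dn]] := Nn.
exact: N_witness (D_scale t Dn) (witness_scale tU Nn).
Qed.

Lemma dag_scale t n : t \is a GRing.unit -> N n -> dag (t *: n) = t^-1 *: dag n.
Proof. by move=> tU Nn;
  exact: dag_unique (N_scale tU Nn) (witness_scale tU Nn). Qed.

(** The order in its usable form: going below [n] is cutting [n] by an
    idempotent. *)
Lemma nle_cut n e : N n -> E e -> n ** e <=N n.
Proof.
move=> Nn Ee; rewrite /nle (dag_mul Nn (N_E Ee)) (dag_E Ee).
by rewrite !mulgA -(mulNE Nn Ee) -(mulgA n e e) (E_idem Ee).
Qed.

Lemma nle_cutP m n : N m -> m <=N n -> exists2 e, E e & m = n ** e.
Proof. by move=> Nm mn; exists (dag m ** m);
  [exact: E_dagN | rewrite mulgA]. Qed.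

Lemma nle_refl n : N n -> n <=N n.
Proof. by move=> Nn; rewrite /nle mulNdN. Qed.

Lemma nle_dag m n : N m -> N n -> m <=N n -> dag m <=N dag n.
Proof.
move=> Nm Nn /(nle_cutP Nm)[e Ee ->]; rewrite dag_mul ?(dag_E Ee) //;
  last exact: N_E.
by rewrite (mulEN (N_dag Nn) Ee) dagK //;
  apply: nle_cut (N_dag Nn) (E_conj Nn Ee).
Qed.

Lemma nle_scale t m n : t \is a GRing.unit -> N m -> N n ->
  m <=N n -> t *: m <=N t *: n.
Proof.
move=> tU Nm Nn /(nle_cutP Nm)[e Ee ->]; rewrite nuZAl.
by apply: nle_cut (N_scale tU Nn) Ee.
Qed.

(** * Ultrafilters as germs *)

Definition efilter (F : set A) : Prop :=
  [/\ F `<=` E, F !=set0, ~ F 0,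
      forall e f, F e -> E f -> e ** f = e -> F f &
      forall e f, F e -> F f -> F (e ** f)].

(** Ultrafilters of the generalised Boolean algebra [idems C]: a filter is
    maximal when every idempotent belongs to it or is disjoint from one of its
    members. *)
Definition eultrafilter (F : set A) : Prop :=
  efilter F /\ forall e, E e -> F e \/ exists2 f, F f & e ** f = 0.

(** For a filter [U] these are the idempotents above some [dag u ** u] with [u]
    in [U]. *)
Definition src_filter (U : set A) : set A :=
  [set e | E e /\ exists2 u, U u & u ** e = u].

Definition germ (u : A) (F : set A) : set A :=
  [set m | N m /\ exists2 f, F f & u ** f = m ** f].

Lemma eultrafilter_max F F' : eultrafilter F -> efilter F' -> F `<=` F' ->
  F' = F.
Proof.
move=> [[FE _ _ _ _] Fm] [F'E _ F'0 _ F'M] FF'; apply/seteqP; split=> // e F'e.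
have [//|[f Ff ef0]] := Fm e (F'E _ F'e).
by case: F'0; rewrite -ef0; apply: F'M => //; exact: FF'.
Qed.

Section Filter.
Variable U : set A.
Hypothesis fU : nfilter D C U.

Lemma nfilterN u : U u -> N u.
Proof. by case: fU => _ UN _ _ /UN[]. Qed.

Lemma nfilter_neq0 u : U u -> u <> 0.
Proof. by case: fU => _ UN _ _ /UN[_]. Qed.

Lemma nfilter_up u m : U u -> N m -> u <=N m -> U m.
Proof. by case: fU => _ _ eU _ Uu Nm um; rewrite eU; split=> //; exists u. Qed.

(** With [v ** e = v] for a member [v], a common lower bound [p] of [u] and [v]
    satisfies [p = p ** e], hence lies below [u ** e]. *)
Lemma nfilter_cut u e : U u -> src_filter U e -> U (u ** e).
Proof.
move=> Uu [Ee [v Uv ve]]; have [_ _ _ Ud] := fU.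
have [p [Up pu pv]] := Ud _ _ Uu Uv; have Np := nfilterN Up.
have Nu := nfilterN Uu.
apply: (nfilter_up Up); first exact/N_mul/N_E.
have [f Ef pf] := nle_cutP Np pv; have [g Eg pg] := nle_cutP Np pu.
have pe : p ** e = p by rewrite pf (mulE_AC _ Ef Ee) ve.
rewrite -pe pg (mulE_AC _ Eg Ee).
by apply: nle_cut => //; exact/N_mul/N_E.
Qed.

Lemma src_filter_dagN u : U u -> src_filter U (dag u ** u).
Proof.
move=> Uu; have Nu := nfilterN Uu; split; first exact: E_dagN.
by exists u => //; rewrite mulgA mulNdN.
Qed.

Lemma efilter_src : efilter (src_filter U).
Proof.
have [[u Uu] _ _ Ud] := fU; split.
- by move=> e [].
- by exists (dag u ** u); exact: src_filter_dagN.
- by move=> [_ [v /nfilter_neq0 v0]]; rewrite nu_mul0r => /esym.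
- move=> e f [Ee [v Uv ve]] Ef ef; split=> //; exists v => //.
  by rewrite -ve -mulgA ef.
- move=> e f Se Sf; have [Ee _] := Se; have [Ef _] := Sf.
  split; first exact: E_mul.
  exists (u ** e ** f); first by apply: nfilter_cut => //; exact: nfilter_cut.
  by rewrite !mulgA (mulE_AC _ Ef Ee) !mulEE.
Qed.

(** Two members of a filter agree on [dag p ** p] for a common lower bound
    [p]. *)
Lemma nfilter_germ u : U u -> U = germ u (src_filter U).
Proof.
move=> Uu; have [_ _ _ Ud] := fU; have Nu := nfilterN Uu.
apply/seteqP; split=> m.
- move=> Um; split; first exact: nfilterN.
  have [p [Up pu pm]] := Ud _ _ Uu Um.
  by exists (dag p ** p); [exact: src_filter_dagN | rewrite !mulgA -pu -pm].
- move=> [Nm [f Sf uf]]; apply: (nfilter_up (nfilter_cut Uu Sf)) => //.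
  by rewrite uf; apply: nle_cut => //; case: Sf.
Qed.

End Filter.

Section Germ.
Variables (u : A) (F : set A).
Hypotheses (Nu : N u) (fF : efilter F) (Fu : F (dag u ** u)).

Lemma efilterE e : F e -> E e. Proof. by case: fF => FE _ _ _ _ /FE. Qed.

Lemma germ_cut e : F e -> germ u F (u ** e).
Proof.
move=> Fe; have Ee := efilterE Fe; split; first exact/N_mul/N_E.
by exists e; rewrite // -mulgA E_idem.
Qed.

Lemma germ_self : germ u F u.
Proof. by split=> //; exists (dag u ** u). Qed.

(** If [u ** f = m ** f], then [dag u ** u] and [dag m ** m] agree below
    [f]. *)
Lemma germ_dagN m : germ u F m -> F (dag m ** m).
Proof.
move=> [Nm [f Ff uf]]; have [_ _ _ Fup FM] := fF; have Ef := efilterE Ff.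
apply: Fup (FM _ _ Fu Ff) _ _; first exact: E_dagN.
have dE n : N n -> dag (n ** f) ** (n ** f) = dag n ** n ** f.
  move=> Nn; rewrite (dag_mul Nn (N_E Ef)) (dag_E Ef) !mulgA.
  by rewrite -(E_dagN_comm Nn Ef) mulEE.
have := dE m Nm; rewrite -uf (dE u Nu) => ->.
by rewrite (mulE_AC _ Ef (E_dagN Nm)) (E_idem (E_dagN Nm)).
Qed.

Lemma nfilter_of_germ : nfilter D C (germ u F).
Proof.
have [FE _ F0 Fup FM] := fF; split.
- by exists u; exact: germ_self.
- move=> m [Nm [f Ff uf]]; split=> // m0; apply: F0.
  by have := FM _ _ Fu Ff; rewrite -mulgA uf m0 nu_mul0l nu_mul0r.
- apply/seteqP; split=> [m gm|k [Nk [m gm mk]]].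
    by have [Nm _] := gm; split=> //; exists m => //; exact: nle_refl.
  split=> //; have [Nm [f Ff uf]] := gm; have Ef := efilterE Ff.
  have Fd := germ_dagN gm; have Ed := efilterE Fd.
  exists (dag m ** m ** f); first exact: FM.
  rewrite (E_comm Ed Ef) [LHS]mulgA uf -(mulgA m f) (E_comm Ef Ed).
  by rewrite !mulgA mulNdN // -mk.
- move=> m n [Nm [f Ff uf]] [Nn [g Fg ug]].
  have Ef := efilterE Ff; have Eg := efilterE Fg.
  exists (u ** (f ** g)); split; first exact/germ_cut/FM.
    by rewrite mulgA uf -mulgA; apply/nle_cut/E_mul.
  by rewrite (E_comm Ef Eg) mulgA ug -mulgA; apply/nle_cut/E_mul.
Qed.

Lemma src_filter_germ : src_filter (germ u F) = F.
Proof.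
have [FE _ F0 Fup FM] := fF; apply/seteqP; split=> e.
- move=> [Ee [m gm me]]; apply: Fup (germ_dagN gm) Ee _.
  by rewrite -mulgA me.
- move=> Fe; split; first exact: FE.
  exists (u ** e); first exact: germ_cut.
  by rewrite -mulgA E_idem //; exact: FE.
Qed.

End Germ.

(** Enlarging the source filter of [U] by an idempotent that meets all of it
    would enlarge [U]. *)
Lemma eultrafilter_src U : nultrafilter D C U -> eultrafilter (src_filter U).
Proof.
move=> [fU mU]; have fF := efilter_src fU; split=> // e Ee.
have [[u Uu] _ _ _] := fU; have Nu := nfilterN fU Uu.
have [FE _ F0 Fup FM] := fF; have Fu := src_filter_dagN fU Uu.
(* Otherwise the filter generated by the source and [e] is proper. *)
have [|noF] := pselect (exists2 f, src_filter U f & e ** f = 0); first by right.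
left; pose F' := [set g | E g /\
  exists2 f, src_filter U f & e ** f ** g = e ** f].
have FF' : src_filter U `<=` F'.
  move=> f Sf; split; first exact: FE.
  by exists f => //; rewrite -mulgA E_idem //; exact: FE.
have fF' : efilter F'.
  split.
  - by move=> g [].
  - by exists (dag u ** u); exact: FF'.
  - by move=> [_ [f Sf]]; rewrite nu_mul0r => /esym ef0; apply: noF; exists f.
  - move=> g h [Eg [f Sf efg]] Eh gh; split=> //; exists f => //.
    by rewrite -efg -mulgA gh.
  - move=> g h [Eg [f Sf efg]] [Eh [f' Sf' efh]]; split; first exact: E_mul.
    have Ef := FE _ Sf; have Ef' := FE _ Sf'.
    exists (f ** f'); first exact: FM.
    by rewrite !mulgA (mulE_AC _ Ef' Eg) efg (mulE_AC _ Ef Ef') (mulE_AC _ Ef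
      Eh) efh.
have F'u := FF' _ Fu.
have <- : germ u F' = U.
  apply: mU; first exact: nfilter_of_germ.
  rewrite {1}(nfilter_germ fU Uu) => m [Nm [f Sf uf]].
  by split=> //; exists f => //; exact: FF'.
rewrite (src_filter_germ Nu fF' F'u); split=> //; exists (dag u ** u) => //.
by rewrite -(mulgA e) (E_comm (E_dagN Nu) Ee) mulgA E_idem.
Qed.

(** A larger filter is the germ of [u] at a larger source, and the source is
    already maximal. *)
Lemma nultrafilter_germ u F : N u -> eultrafilter F -> F (dag u ** u) ->
  nultrafilter D C (germ u F).
Proof.
move=> Nu uF Fu; have [fF _] := uF; have fG := nfilter_of_germ Nu fF Fu.
split=> // W fW GW.
have Wu : W u by apply/GW/germ_self.
rewrite (nfilter_germ fW Wu); congr germ.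
apply: eultrafilter_max => //; first exact: efilter_src.
rewrite -{1}(src_filter_germ Nu fF Fu) => e [Ee [m gm me]].
by split=> //; exists m => //; exact: GW.
Qed.

(** Inversion and multiplication by a unit of [R] are both automorphisms of the
    order that fix 0, and such maps preserve ultrafilters. *)
Lemma nfilter_image (phi psi : A -> A) U :
    (forall n, N n -> N (phi n)) -> (forall n, N n -> N (psi n)) ->
    (forall n, N n -> psi (phi n) = n) -> (forall n, N n -> phi (psi n) = n) ->
    (forall m n, N m -> N n -> m <=N n -> phi m <=N phi n) ->
    (forall m n, N m -> N n -> m <=N n -> psi m <=N psi n) ->
    psi 0 = 0 -> nfilter D C U -> nfilter D C (phi @` U).
Proof.
move=> Nphi Npsi phiK psiK phi_le psi_le psi0 fU.
have UN u : U u -> N u by exact: nfilterN fU u.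
have [[u Uu] _ _ Ud] := fU; split.
- by exists (phi u), u.
- move=> _ [m Um <-]; split; first exact/Nphi/UN.
  by move=> /= p0; apply: (nfilter_neq0 fU Um); rewrite -(phiK m (UN _ Um)) p0.
- apply/seteqP; split=> [_ [m Um <-]|m [Nm [_ [n Un <-] nm]]].
    split; first exact/Nphi/UN.
    by exists (phi m); [exists m | exact/nle_refl/Nphi/UN].
  exists (psi m); last exact: psiK.
  apply: (nfilter_up fU Un (Npsi _ Nm)).
  rewrite -[n](phiK _ (UN _ Un)); apply: psi_le => //; exact/Nphi/UN.
- move=> _ _ [m Um <-] [n Un <-]; have [p [Up pm pn]] := Ud _ _ Um Un.
  by exists (phi p); split; [exists p | apply: phi_le => //; exact: UN..].
Qed.

Lemma nultrafilter_image (phi psi : A -> A) U :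
    (forall n, N n -> N (phi n)) -> (forall n, N n -> N (psi n)) ->
    (forall n, N n -> psi (phi n) = n) -> (forall n, N n -> phi (psi n) = n) ->
    (forall m n, N m -> N n -> m <=N n -> phi m <=N phi n) ->
    (forall m n, N m -> N n -> m <=N n -> psi m <=N psi n) ->
    phi 0 = 0 -> psi 0 = 0 ->
  nultrafilter D C U -> nultrafilter D C (phi @` U).
Proof.
move=> Nphi Npsi phiK psiK phi_le psi_le phi0 psi0 [fU mU].
have image_id (f g : A -> A) (W : set A) : W `<=` N ->
    (forall n, N n -> g (f n) = n) -> g @` (f @` W) = W.
  move=> WN fK; apply/seteqP; split=> [_ [_ [m Wm <-] <-]|m Wm].
    by rewrite fK //; exact: WN.
  by exists (f m); [exists m | rewrite fK //; exact: WN].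
have UN : U `<=` N by move=> u; exact: nfilterN fU u.
split; first exact: nfilter_image psiK phi_le psi_le psi0 fU.
move=> W fW UW; have WN : W `<=` N by move=> w; exact: nfilterN fW w.
rewrite -(image_id psi phi W WN psiK); congr (_ @` _).
apply: mU; first exact: nfilter_image phiK psi_le phi_le phi0 fW.
by rewrite -{1}(image_id phi psi U UN phiK); exact: image_subset.
Qed.

Lemma nultrafilter_inverse U : nultrafilter D C U ->
  nultrafilter D C (set_inverse C U).
Proof.
apply: (nultrafilter_image (psi := dag)).
1,2: exact: N_dag.
1,2: exact: dagK.
1,2: exact: nle_dag.
1,2: exact/dag_E/E0.
Qed.

Lemma nultrafilter_scale (t : Runits R) U :
  nultrafilter D C U -> nultrafilter D C (set_scale t U).
Proof.
have tU := svalP t.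
apply: (nultrafilter_image (psi := fun m => (sval t)^-1 *: m)) => //.
- by move=> n; exact: N_scale.
- by move=> n; apply: N_scale; rewrite unitrV.
- by move=> n _; rewrite scalerA mulVr // scale1r.
- by move=> n _; rewrite scalerA divrr // scale1r.
- by move=> m n; exact: nle_scale.
- by move=> m n; apply: nle_scale; rewrite unitrV.
- exact: scaler0.
- exact: scaler0.
Qed.

(** * The groupoid of ultrafilters *)

Local Notation Sig := (Sigma_star D C).
Local Notation inv := (ginv (Sigma_star_groupoid D C)).
Local Notation comp := (gcomp (Sigma_star_groupoid D C)).
Local Notation prd := (gmul (Sigma_star_groupoid D C)).
Local Notation "t *^ U" := (Sigma_star_scale t U) (at level 40).
Implicit Types U V W : Sig.

Definition ultra_of (S : set A) (uS : nultrafilter D C S) : Sig :=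
  exist (fun S => is_true `[< nultrafilter D C S >]) S (asboolT uS).

Lemma ultraP U : nultrafilter D C (val U).
Proof. exact/asboolP/(valP U). Qed.

Lemma ultra_filter U : nfilter D C (val U). Proof. by case: (ultraP U). Qed.

Lemma val_insubd_ultra U (S : set A) : nultrafilter D C S ->
  val (insubd U S) = S.
Proof. by move=> uS; apply/insubdK/asboolP. Qed.

Definition src_of U : set A := src_filter (val U).

(** As a filter of idempotents, the range is the source of the inverse;
    [rng_ofP] describes it by left multiplication. *)
Definition rng_of U : set A := src_of (inv U).

Lemma eultrafilter_src_of U : eultrafilter (src_of U).
Proof. exact/eultrafilter_src/ultraP. Qed.

Lemma src_of_E U e : src_of U e -> E e. Proof. by case. Qed.

Lemma src_of_dagN U u : val U u -> src_of U (dag u ** u).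
Proof. exact/src_filter_dagN/ultra_filter. Qed.

Lemma ultraN U u : val U u -> N u. Proof. exact/nfilterN/ultra_filter. Qed.

Lemma ultra_neq0 U u : val U u -> u <> 0.
Proof. exact/nfilter_neq0/ultra_filter. Qed.

Lemma ultra_ex U : exists u, val U u.
Proof. by have [[u Uu] _ _ _] := ultra_filter U; exists u. Qed.

Lemma ultra_up U u m : val U u -> N m -> u <=N m -> val U m.
Proof. exact: (nfilter_up (ultra_filter U)). Qed.

Lemma ultra_meet U m n : val U m -> val U n ->
  exists p, [/\ val U p, p <=N m & p <=N n].
Proof. by have [_ _ _] := ultra_filter U; apply. Qed.

Lemma ultra_cut U u e : val U u -> src_of U e -> val U (u ** e).
Proof. exact: (nfilter_cut (ultra_filter U)). Qed.

Lemma ultra_germ U u : val U u -> val U = germ u (src_of U).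
Proof. exact/nfilter_germ/ultra_filter. Qed.

(** Both sides are the germ of [u] at the common source; this reduces identities
    between ultrafilters to computing sources and one member. *)
Lemma ultra_eq U V u : src_of U = src_of V -> val U u -> val V u -> U = V.
Proof.
by move=> sUV Uu Vu; apply: val_inj;
  rewrite /= (ultra_germ Uu) (ultra_germ Vu) sUV.
Qed.

Lemma src_of_efilter U : efilter (src_of U).
Proof. exact: (efilter_src (ultra_filter U)). Qed.

Lemma src_of_sub_eq U V : src_of U `<=` src_of V -> src_of U = src_of V.
Proof.
by move=> UV; apply/esym/eultrafilter_max;
  [exact: eultrafilter_src_of | exact: src_of_efilter |].
Qed.

Lemma src_of_mul U e f : src_of U e -> src_of U f -> src_of U (e ** f).
Proof. by have [_ _ _ _] := src_of_efilter U; apply. Qed.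

Lemma src_of_up U e f : src_of U e -> E f -> e ** f = e -> src_of U f.
Proof. by have [_ _ _ + _] := src_of_efilter U; apply. Qed.

Lemma src_of_neq0 U : ~ src_of U 0.
Proof. by have [_ _ +] := src_of_efilter U. Qed.

Lemma src_of_dec U e : E e -> src_of U e \/ exists2 f, src_of U f & e ** f = 0.
Proof. by have [_] := eultrafilter_src_of U; apply. Qed.

Lemma val_inv U : val (inv U) = set_inverse C (val U).
Proof. exact/val_insubd_ultra/nultrafilter_inverse/ultraP. Qed.

Lemma mem_inv U m : val (inv U) m <-> N m /\ val U (dag m).
Proof.
rewrite val_inv; split=> [[u Uu <-]|[Nm Um]].
  by have Nu := ultraN Uu; split; [exact: N_dag | rewrite dagK].
by exists (dag m); rewrite ?dagK.
Qed.

Lemma inv_dag U u : val U u -> val (inv U) (dag u).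
Proof. by move=> Uu; rewrite val_inv; exists u. Qed.

Lemma invK U : inv (inv U) = U.
Proof.
apply: val_inj; apply/seteqP; split=> m /=.
  by move=> /mem_inv[Nm /mem_inv[_]]; rewrite dagK.
by move=> Um; have Nm := ultraN Um; rewrite -[m]dagK //; exact/inv_dag/inv_dag.
Qed.

Lemma rng_ofP U e : rng_of U e <-> E e /\ exists2 u, val U u & e ** u = u.
Proof.
split=> -[Ee [u]].
  move=> /mem_inv[Nu Uu] ue; split=> //; exists (dag u) => //.
  by rewrite -[in RHS]ue dag_mul ?(dag_E Ee) //; exact: N_E.
move=> Uu eu; have Nu := ultraN Uu; split=> //; exists (dag u);
  first exact: inv_dag.
by rewrite -[in RHS]eu dag_mul ?(dag_E Ee) //; exact: N_E.
Qed.

Lemma rng_of_Ndag U u : val U u -> rng_of U (u ** dag u).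
Proof.
move=> Uu; have := src_of_dagN (inv_dag Uu); rewrite dagK //; exact: ultraN Uu.
Qed.

Lemma ultra_cutl U u e : val U u -> rng_of U e -> val U (e ** u).
Proof.
move=> Uu Re; have Nu := ultraN Uu; have Ee := src_of_E Re.
have := ultra_cut (inv_dag Uu) Re; move=> /mem_inv[_].
by rewrite dag_mul ?dagK ?(dag_E Ee) //; [exact: N_dag | exact: N_E].
Qed.

(** Composability is equality of range and source because distinct ultrafilters
    of idempotents contain disjoint idempotents. *)
Lemma compP U V : comp U V <-> src_of U = rng_of V.
Proof.
split=> /= [UV|UV m n Um Vn].
  apply: src_of_sub_eq => e [Ee [u Uu ue]].
  have [//|[f Sf ef0]] := src_of_dec (inv V) Ee.
  have [_ [v Vv fv]] := (rng_ofP V f).1 Sf.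
  have /eqP[] := UV _ _ Uu Vv.
  by rewrite -ue -fv mulgA -(mulgA u) ef0 nu_mul0r nu_mul0l.
apply/eqP => mn0; apply: (@src_of_neq0 U).
have := src_of_mul (src_of_dagN Um); rewrite UV => /(_ _ (rng_of_Ndag Vn)).
by rewrite mulgA -(mulgA (dag m)) mn0 nu_mul0r nu_mul0l.
Qed.

(** The product of germs is a germ at the source of the right factor. A member
    [m ** n] agrees with [u ** v] there because the cut that identifies [m] with
    [u] can be moved across [v] and [n]. *)
Lemma set_product_germ U V u v : comp U V -> val U u -> val V v ->
  [/\ src_of V (dag (u ** v) ** (u ** v)) &
      set_product D C (val U) (val V) = germ (u ** v) (src_of V)].
Proof.
move=> /compP UV Uu Vv; have Nu := ultraN Uu; have Nv := ultraN Vv.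
have Nuv := N_mul Nu Nv.
(* An idempotent of the common filter [src_of U = rng_of V] can be absorbed on
   the right of [v] by a member of [src_of V]. *)
have absorb e n : val V n -> src_of U e ->
    exists2 g, src_of V g & e ** n ** g = n ** g.
  move=> Vn Se; have Ven : val V (e ** n) by apply: ultra_cutl => //;
    rewrite -UV.
  move: (Vn); rewrite (ultra_germ Ven) => -[_ [g Sg eg]].
  by exists g.
have Suv : src_of V (dag (u ** v) ** (u ** v)).
  have [g Sg eg] := absorb _ _ Vv (src_of_dagN Uu).
  have Eg := src_of_E Sg.
  apply: src_of_up (src_of_mul (src_of_dagN Vv) Sg) (E_dagN Nuv) _.
  rewrite (E_comm (E_mul (E_dagN Nv) Eg) (E_dagN Nuv)) dag_mul // !mulgA.
  by rewrite (under_mul3 _ (mulNdN Nv)) (under_mul4 _ eg) mulgA.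
split=> //; apply/seteqP; split=> x.
- move=> [Nx [_ [[m n] [/= Um Vn] <-] mnx]].
  move: (Um); rewrite (ultra_germ Uu) => -[Nm [e Se ue]].
  move: (Vn); rewrite (ultra_germ Vv) => -[Nn [f Sf vf]].
  have Ef := src_of_E Sf.
  have [g Sg evg] := absorb _ _ Vv Se; have [g' Sg' eng'] := absorb _ _ Vn Se.
  have [Eg Eg'] := (src_of_E Sg, src_of_E Sg').
  have fG := nfilter_of_germ Nuv (src_of_efilter V) Suv.
  apply: (nfilter_up fG) Nx mnx; split; first exact: N_mul.
  exists (f ** g ** g'); first exact/src_of_mul/Sg'/src_of_mul.
  have vh : v ** (f ** g ** g') = n ** (f ** g ** g') by rewrite !mulgA vf.
  have evh : e ** (v ** (f ** g ** g')) = v ** (f ** g ** g').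
    by rewrite !mulgA (mulE_AC _ Ef Eg) evg (mulE_AC _ Ef Eg).
  have enh : e ** (n ** (f ** g ** g')) = n ** (f ** g ** g').
    rewrite !mulgA (mulE_AC _ Eg Eg') (mulE_AC _ Ef Eg') eng'.
    by rewrite (mulE_AC _ Eg Eg') (mulE_AC _ Ef Eg').
  by rewrite -mulgA -evh vh (mulgA u) ue -(mulgA m e) enh mulgA.
- move=> [Nx [f Sf uvf]]; split=> //; exists (u ** (v ** f)).
    by exists (u, v ** f) => //; split=> //=; exact: ultra_cut.
  by rewrite mulgA uvf; apply: nle_cut => //; exact: src_of_E Sf.
Qed.

Lemma nultrafilter_product U V : comp U V ->
  nultrafilter D C (set_product D C (val U) (val V)).
Proof.
move=> UV; have [[u Uu] [v Vv]] := (ultra_ex U, ultra_ex V).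
have [Suv ->] := set_product_germ UV Uu Vv.
by apply: nultrafilter_germ => //;
  [exact/N_mul/(ultraN Vv)/(ultraN Uu) | exact: eultrafilter_src_of].
Qed.

Lemma val_prd U V : comp U V -> val (prd U V) = set_product D C (val U) (val V).
Proof. by move=> /nultrafilter_product; exact: val_insubd_ultra. Qed.

Lemma prd_mem U V u v : comp U V -> val U u -> val V v ->
  val (prd U V) (u ** v).
Proof.
move=> UV Uu Vv; have [Suv] := set_product_germ UV Uu Vv.
rewrite -val_prd // => ->; apply: germ_self => //.
by apply: N_mul; [exact: ultraN Uu | exact: ultraN Vv].
Qed.

Lemma src_prd U V : comp U V -> src_of (prd U V) = src_of V.
Proof.
move=> UV; have [[u Uu] [v Vv]] := (ultra_ex U, ultra_ex V).
have [Suv] := set_product_germ UV Uu Vv.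
rewrite /src_of -val_prd // => ->; apply: src_filter_germ => //;
  last exact: src_of_efilter.
by apply: N_mul; [exact: ultraN Uu | exact: ultraN Vv].
Qed.

Lemma src_inv U : src_of (inv U) = rng_of U. Proof. by []. Qed.
Lemma rng_inv U : rng_of (inv U) = src_of U. Proof. by rewrite /rng_of invK.
  Qed.

Lemma rng_prd U V : comp U V -> rng_of (prd U V) = rng_of U.
Proof.
move=> UV; apply/esym/src_of_sub_eq => e /rng_ofP[Ee [u Uu eu]].
have [v Vv] := ultra_ex V.
by apply/rng_ofP; split=> //; exists (u ** v); rewrite ?mulgA ?eu //;
  exact: prd_mem.
Qed.

Lemma comp_invl U : comp (inv U) U. Proof. by apply/compP. Qed.
Lemma comp_invr U : comp U (inv U). Proof. by apply/compP; rewrite rng_inv. Qed.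

Lemma Sigma_is_groupoid : is_groupoid (Sigma_star_groupoid D C).
Proof.
split.
- exact: invK.
- move=> U V W UV VW; have [[u Uu] [v Vv]] := (ultra_ex U, ultra_ex V).
  have [w Ww] := ultra_ex W.
  have UV_W : comp (prd U V) W by apply/compP; rewrite src_prd //; exact/compP.
  have U_VW : comp U (prd V W) by apply/compP; rewrite rng_prd //; exact/compP.
  split=> //; apply: (@ultra_eq _ _ (u ** v ** w)).
  + by rewrite !src_prd.
  + by apply: prd_mem => //; exact: prd_mem.
  + by rewrite -mulgA; apply: prd_mem => //; exact: prd_mem.
- by move=> U; split; [exact: comp_invl | exact: comp_invr].
- move=> U V UV; have [[u Uu] [v Vv]] := (ultra_ex U, ultra_ex V).
  have UUV : comp (inv U) (prd U V) by apply/compP; rewrite rng_prd.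
  apply: (@ultra_eq _ _ (dag u ** (u ** v))).
  + by rewrite !src_prd.
  + by apply: prd_mem; [|exact: inv_dag|exact: prd_mem].
  + rewrite mulgA; apply: ultra_cutl => //; rewrite -(compP U V).1 //.
    exact: src_of_dagN.
- move=> U V VU; have [[u Uu] [v Vv]] := (ultra_ex U, ultra_ex V).
  have VUU : comp (prd V U) (inv U) by apply/compP; rewrite src_prd // rng_inv.
  apply: (@ultra_eq _ _ (v ** u ** dag u)).
  + by rewrite src_prd //; apply/esym/compP.
  + by apply: prd_mem; [|exact: prd_mem|exact: inv_dag].
  + rewrite -mulgA; apply: ultra_cut => //; rewrite (compP V U).1 //.
    exact: rng_of_Ndag.
Qed.

Local Notation units := (Sigma_star_units (D := D) (C := C)).

(** An idempotent member makes source and range coincide: [e ** f = f ** e] is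
    fixed by [f] on both sides. *)
Lemma units_inv U : units U -> inv U = U.
Proof.
move=> [e [Ue Ee]]; apply: (@ultra_eq _ _ e) => //; last first.
  by rewrite -(dag_E Ee); exact: inv_dag.
apply/esym/src_of_sub_eq => f Sf; have Ef := src_of_E Sf.
apply/rng_ofP; split=> //; exists (e ** f); first exact: ultra_cut.
by rewrite mulgA (E_comm Ef Ee) mulEE.
Qed.

Lemma units_rng U : units U -> rng_of U = src_of U.
Proof. by move=> uU; rewrite /rng_of units_inv. Qed.

Lemma units_mem U e : units U -> src_of U e -> val U e.
Proof.
move=> [f [Uf Ef]] Se; have Ee := src_of_E Se.
apply: (ultra_up (ultra_cut Uf Se) (N_E Ee)).
by rewrite (E_comm Ef Ee); exact/nle_cut/Ef/N_E.
Qed.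

Lemma units_rngO U : units (rng (Sigma_star_groupoid D C) U).
Proof.
have [u Uu] := ultra_ex U; exists (u ** dag u); split;
  last exact/E_Ndag/(ultraN Uu).
by apply: prd_mem => //; [exact: comp_invr | exact: inv_dag].
Qed.

Lemma units_eq U V : units U -> units V -> src_of U = src_of V -> U = V.
Proof.
move=> uU uV sUV; have [e [Ue Ee]] := uU.
have Se : src_of U e by have := src_of_dagN Ue; rewrite dag_E // E_idem.
by apply: (@ultra_eq _ _ e) => //; apply: units_mem; rewrite -?sUV.
Qed.

Lemma src_rngO U : src_of (rng (Sigma_star_groupoid D C) U) = rng_of U.
Proof. by rewrite src_prd //; exact: comp_invr. Qed.

Lemma rngO_units U : units U -> rng (Sigma_star_groupoid D C) U = U.
Proof.
by move=> uU; apply: units_eq => //;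
  [exact: units_rngO | rewrite src_rngO units_rng].
Qed.

Lemma unit_spaceE : unit_space (Sigma_star_groupoid D C) = units.
Proof.
apply/seteqP; split=> [_ [U _ <-]|U uU]; first exact: units_rngO.
by exists U; rewrite ?rngO_units.
Qed.

Lemma val_scale (t : Runits R) U : val (t *^ U) = set_scale t (val U).
Proof. exact/val_insubd_ultra/nultrafilter_scale/ultraP. Qed.

Lemma mem_scale (t : Runits R) U m : val (t *^ U) m <-> val U ((sval t)^-1 *:
  m).
Proof.
have tU := svalP t; rewrite val_scale; split=> [[u Uu <-]|Um].
  by rewrite scalerA mulVr // scale1r.
by exists ((sval t)^-1 *: m); rewrite ?scalerA ?divrr ?scale1r.
Qed.

Lemma scale_mem (t : Runits R) U u : val U u -> val (t *^ U) (sval t *: u).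
Proof. by move=> Uu; rewrite val_scale; exists u. Qed.

Lemma scale1U U : Runit1 R *^ U = U.
Proof. by apply: val_inj; rewrite /= val_scale set_scale1. Qed.

Lemma scaleM (s t : Runits R) U : s *^ (t *^ U) = RunitM s t *^ U.
Proof. by apply: val_inj; rewrite /= !val_scale set_scaleM. Qed.

Lemma src_scale (t : Runits R) U : src_of (t *^ U) = src_of U.
Proof.
have tU := svalP t; apply/esym/src_of_sub_eq => e [Ee [u Uu ue]].
by split=> //; exists (sval t *: u); [exact: scale_mem | rewrite -nuZAl ue].
Qed.

Lemma rng_scale (t : Runits R) U : rng_of (t *^ U) = rng_of U.
Proof.
have tU := svalP t; apply/esym/src_of_sub_eq => e /rng_ofP[Ee [u Uu eu]].
by apply/rng_ofP; split=> //; exists (sval t *: u);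
  [exact: scale_mem | rewrite -nuZAr eu].
Qed.

Lemma comp_scale (s t : Runits R) U V : comp (s *^ U) (t *^ V) <-> comp U V.
Proof. by split=> /compP H; apply/compP; move: H;
  rewrite src_scale rng_scale. Qed.

Lemma prd_scale (s t : Runits R) U V : comp U V ->
  prd (s *^ U) (t *^ V) = RunitM s t *^ prd U V.
Proof.
move=> UV; have [[u Uu] [v Vv]] := (ultra_ex U, ultra_ex V).
have UV' : comp (s *^ U) (t *^ V) by exact/comp_scale.
apply: (@ultra_eq _ _ ((sval s *: u) ** (sval t *: v))).
- by rewrite src_prd // !src_scale src_prd.
- by apply: prd_mem => //; exact: scale_mem.
- have -> : (sval s *: u) ** (sval t *: v) = sval (RunitM s t) *: (u ** v).
    by rewrite -nuZAl -nuZAr scalerA.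
  exact/scale_mem/prd_mem.
Qed.

Lemma inv_scale (t : Runits R) U : inv (t *^ U) = RunitV t *^ inv U.
Proof.
have [u Uu] := ultra_ex U; apply: (@ultra_eq _ _ (dag (sval t *: u))).
- by rewrite src_scale !src_inv rng_scale.
- exact/inv_dag/scale_mem.
- rewrite dag_scale ?(svalP t) //; last exact: ultraN Uu.
  exact/(scale_mem (RunitV t))/inv_dag.
Qed.

(** Cutting by an idempotent does not change the degree, so two members have the
    degree of their nonzero common restriction. *)
Lemma degreeE U n g : val U n -> D g n -> Sigma_star_degree U = g.
Proof.
move=> Un Dn; apply: xget_unique; first by exists n.
move=> h [m Um Dm]; have [p [Up pm pn]] := ultra_meet Um Un.
have Np := ultraN Up; apply: (graded_disjoint gradA (a := p));
  last exact/eqP/(ultra_neq0 Up).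
- have [e Ee ->] := nle_cutP Np pm.
  by rewrite -[h]mulg1; apply: D_mul => //; exact/C_deg1/E_C.
- have [e Ee ->] := nle_cutP Np pn.
  by rewrite -[g]mulg1; apply: D_mul => //; exact/C_deg1/E_C.
Qed.

Lemma ultra_degree U n : val U n -> D (Sigma_star_degree U) n.
Proof. by move=> Un; have [_ [g Dn]] := ultraN Un; rewrite (degreeE Un Dn). Qed.

Lemma degree_prd U V : comp U V ->
  Sigma_star_degree (prd U V) = (Sigma_star_degree U * Sigma_star_degree V)%g.
Proof.
move=> UV; have [[u Uu] [v Vv]] := (ultra_ex U, ultra_ex V).
apply: (degreeE (prd_mem UV Uu Vv)); apply: D_mul; exact: ultra_degree.
Qed.

Lemma degree_scale (t : Runits R) U : Sigma_star_degree (t *^ U) =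
  Sigma_star_degree U.
Proof.
have [u Uu] := ultra_ex U; apply: (degreeE (scale_mem t Uu)).
exact/D_scale/ultra_degree.
Qed.

(** * The topology of the groupoid of ultrafilters *)

Lemma open_basic n : N n -> open (basic_open n : set Sig).
Proof.
move=> Nn; exists [set n]; first by move=> _ ->.
by rewrite bigcup_set1.
Qed.

Lemma nbhs_ultraP U (O : set Sig) :
  nbhs U O <-> exists2 n, val U n & basic_open n `<=` O.
Proof.
rewrite nbhsE; split=> [[O' [[B sB <-] [n Bn Un]] O'O]|[n Un nO]].
  by exists n => // V Vn; apply: O'O; exists n.
exists (basic_open n) => //; split=> //; exact/open_basic/(ultraN Un).
Qed.

Lemma open_ultraP (O : set Sig) :
  open O <-> forall U, O U -> exists2 n, val U n & basic_open n `<=` O.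
Proof.
rewrite openE; split=> oO U OU; first exact/nbhs_ultraP/oO.
exact/nbhs_ultraP/oO.
Qed.

Lemma open_nbhs_ultra (O : set Sig) U : open O -> O U ->
  exists2 n, val U n & basic_open n `<=` O.
Proof. by move=> /open_ultraP; apply. Qed.

Lemma inv_continuous : continuous (inv : Sig -> Sig).
Proof.
apply/continuousP => O /open_ultraP oO; apply/open_ultraP => U /oO[n].
move=> /mem_inv[Nn Udn] nO; exists (dag n) => // V Vn.
by apply: nO; apply/mem_inv.
Qed.

(** Continuity of the product in terms of members, in the form that also serves
    for the range map and for the quotient groupoid. *)
Lemma prd_nbhs U V (O : set Sig) : comp U V -> nbhs (prd U V) O ->
  exists m n, [/\ val U m, val V n & forall U' V', val U' m -> val V' n ->
    comp U' V' -> O (prd U' V')].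
Proof.
move=> UV /nbhs_ultraP[x + xO];
  rewrite val_prd // => -[Nx [_ [[m n] [/= Um Vn] <-] mnx]].
exists m, n; split=> // U' V' Um' Vn' UV'; apply: xO.
exact: ultra_up (prd_mem UV' Um' Vn') Nx mnx.
Qed.

Lemma prd_continuous : {within [set p : Sig * Sig | comp p.1 p.2],
  continuous (fun p : Sig * Sig => prd p.1 p.2)}.
Proof.
apply/subspace_continuousP => -[U V] /= UV O /= nO.
have [m [n [Um Vn mnO]]] := prd_nbhs UV nO.
exists (basic_open m, basic_open n) => /=; last first.
  by move=> [U' V'] /= [Um' Vn'] UV'; exact: mnO.
by split; apply/nbhs_ultraP; [exists m | exists n].
Qed.

Lemma Sigma_topological_groupoid : topological_groupoid (Sigma_star_groupoid D
  C).
Proof.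
split; [exact: Sigma_is_groupoid | exact: inv_continuous |
  exact: prd_continuous].
Qed.

Local Notation rngS := (rng (Sigma_star_groupoid D C)).

Lemma rng_continuous : continuous (rngS : Sig -> Sig).
Proof.
apply/continuousP => O oO; apply/open_ultraP => U /= OU.
have := open_nbhs_nbhs (conj oO OU);
  move=> /(prd_nbhs (@comp_invr U))[m [n [Um Un mnO]]].
move: (Un) => /mem_inv[Nn Udn].
have [p [Up pm pn]] := ultra_meet Um Udn.
exists p => // V Vp; apply: mnO (@comp_invr V).
  exact: ultra_up Vp (ultraN Um) pm.
by apply/mem_inv; split=> //; exact: ultra_up Vp (ultraN Udn) pn.
Qed.

(** The ultrafilter with range [W] through [n] is the inverse of the germ of
    [dag n] at the source of [W]. *)
Lemma unit_lift W n : units W -> val W (n ** dag n) -> N n ->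
  exists2 U, val U n & rngS U = W.
Proof.
move=> uW Wn Nn; have Ndn := N_dag Nn.
have Sn : src_of W (dag (dag n) ** dag n).
  rewrite dagK //; have := src_of_dagN Wn.
  by rewrite dag_E ?E_idem //; exact: E_Ndag.
have uG := nultrafilter_germ Ndn (eultrafilter_src_of W) Sn.
pose V := ultra_of uG.
have Vn : val V (dag n) by exact: germ_self Sn.
have sV : src_of V = src_of W by exact: src_filter_germ (src_of_efilter W) Sn.
exists (inv V); first by have := inv_dag Vn; rewrite dagK.
apply: units_eq => //; first exact: units_rngO.
by rewrite src_rngO rng_inv.
Qed.

Lemma rng_open (O : set Sig) : open O -> open (rngS @` O).
Proof.
move=> /open_ultraP oO; apply/open_ultraP => _ [U /oO[n Un nO] <-].
have Nn := ultraN Un; exists (n ** dag n).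
  by apply: prd_mem => //; [exact: comp_invr | exact: inv_dag].
move=> W Wn; have uW : units W by exists (n ** dag n); split=> //;
  exact: E_Ndag.
by have [V Vn <-] := unit_lift uW Wn Nn; exists V => //; exact: nO.
Qed.

Lemma units_open : open (units : set Sig).
Proof.
apply/open_ultraP => U [e [Ue Ee]]; exists e => // V Ve.
by exists e.
Qed.

(** Compactness is that of the Stone space of [idems C]: along a topological
    ultrafilter containing [basic_open n], the idempotents [e] with
    [basic_open (n ** e)] in it form an ultrafilter, whose germ at [n] is the
    limit. *)
Lemma compact_basic n : N n -> compact (basic_open n : set Sig).
Proof.
move=> Nn; rewrite compact_ultra /= => F uF Fn.
pose B e : set Sig := basic_open (n ** e).
have BE e U : E e -> B e U <-> val U n /\ src_of U e.
  move=> Ee; split=> [Une|[Un Se]]; last exact: ultra_cut.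
  split; first exact: ultra_up Une Nn (nle_cut Nn Ee).
  by split=> //; exists (n ** e) => //; rewrite mulEE.
pose L := [set e | E e /\ F (B e)].
have fL : efilter L.
  split.
  - by move=> e [].
  - by exists (dag n ** n); split; [exact: E_dagN | rewrite /B mulgA mulNdN].
  - move=> [_]; rewrite /B nu_mul0r => F0.
    have [U /= U0] := filter_ex F0; exact: ultra_neq0 U0 erefl.
  - move=> e f [Ee Fe] Ef ef; split=> //;
      apply: filterS Fe => U /(BE _ _ Ee)[Un Se].
    by apply/BE => //; split=> //; exact: src_of_up Se Ef ef.
  - move=> e f [Ee Fe] [Ef Ff]; have Eef := E_mul Ee Ef; split=> //.
    apply: filterS (filterI Fe Ff) => U [/(BE _ _ Ee)[Un Se] /(BE _ _ Ef)[_
      Sf]].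
    by apply/BE => //; split=> //; exact: src_of_mul.
have uL : eultrafilter L.
  split=> // e Ee; have Ed := E_dagN Nn.
  have [Fe|Fe] := in_ultra_setVsetC (B e) uF; first by left.
  right; exists (dag n ** n - dag n ** n ** e); last first.
    by rewrite nu_mulBr (mulgA e _ e) (E_comm Ee Ed) mulEE // subrr.
  have Ede := E_sub Ed Ee.
  split=> //; apply: filterS (filterI Fn Fe) => U [/= Un nBe].
  apply/BE => //; split=> //.
  have [Se|[f Sf ef0]] := src_of_dec U Ee; first by case: nBe; apply/BE.
  apply: src_of_up (src_of_mul (src_of_dagN Un) Sf) Ede _.
  have Ef := src_of_E Sf.
  rewrite nu_mulBr (mulgA _ _ e) (mulE_AC _ Ef Ed) (E_idem Ed).
  by rewrite -(mulgA _ f) (E_comm Ef Ee) ef0 nu_mul0r subr0.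
have Ln : L (dag n ** n) by split; [exact: E_dagN | rewrite /B mulgA mulNdN].
have uG := nultrafilter_germ Nn uL Ln.
pose V := ultra_of uG.
exists V; split; first exact: germ_self Ln.
move=> O /nbhs_ultraP[m [Nm [f [Ef Ff] nf]] mO].
apply: filterS Ff => U; rewrite /B nf => Umf; apply: mO.
exact: ultra_up Umf Nm (nle_cut Nm Ef).
Qed.

(** * The free action of the units of the ring *)

Hypothesis wtC : without_torsion C.

Lemma nonzero_scalar e (s t : R) : E e -> e <> 0 -> s *: e = t *: e -> s = t.
Proof.
move=> Ee /eqP e0 /eqP; rewrite -subr_eq0 -scalerBl => /eqP /(wtC Ee e0)/eqP.
by rewrite subr_eq0 => /eqP.
Qed.

(** The units of [R] act freely, by the absence of torsion: a member of both
    [U] and [t *^ U] has a nonzero restriction fixed by [t^-1]. *)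
Lemma scale_free (t : Runits R) U n : val U n -> val (t *^ U) n -> t = Runit1 R.
Proof.
move=> Un /mem_scale Utn; have [p [Up pn ptn]] := ultra_meet Un Utn.
have Np := ultraN Up; have Sp := src_of_dagN Up.
have tp : (sval t)^-1 *: p = 1 *: p.
  by rewrite scale1r; move: ptn; rewrite /nle -!nuZAl -[n ** _ ** _]pn.
apply: val_inj => /=; apply: invr_inj; rewrite invr1.
apply: (nonzero_scalar (src_of_E Sp)); first by move=> p0; rewrite p0 in Sp;
  exact: src_of_neq0 Sp.
by rewrite nuZAr tp -nuZAr.
Qed.

Lemma units_scale (t : Runits R) U : units U -> units (t *^ U) -> t = Runit1 R.
Proof.
move=> uU utU; have [e Se] : exists e, src_of U e.
  by have [u Uu] := ultra_ex U; exists (dag u ** u); exact: src_of_dagN.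
by apply: (@scale_free _ U e); apply: units_mem; rewrite ?src_scale.
Qed.

Lemma scale_inj (s t : Runits R) U : s *^ U = t *^ U -> s = t.
Proof.
move=> stU; have [u Uu] := ultra_ex U.
have /(@scale_free _ U u Uu) st : val (RunitM (RunitV s) t *^ U) u.
  rewrite -scaleM -stU scaleM; apply/mem_scale.
  by rewrite /= mulVr ?invr1 ?scale1r // (svalP s).
apply: val_inj; apply: (mulrI (x := (sval s)^-1)).
  by rewrite unitrV (svalP s).
by have /= := congr1 sval st; rewrite mulVr ?(svalP s).
Qed.

(** * The quotient groupoid *)

Local Notation G := (G_star D C).
Local Notation q := (@q_star R A Gamma D C).
Local Notation oG := (G_star_groupoid D C).
Local Notation invG := (ginv oG).
Local Notation prdG := (gmul oG).
Local Notation compG := (gcomp oG).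
Local Notation rngG := (rng oG).
Implicit Types x y z : G.

Lemma val_eq_scale (t : Runits R) U V : val U = set_scale t (val V) <-> U = t
  *^ V.
Proof.
split=> [UV|->]; last by rewrite val_scale.
by apply: val_inj; rewrite /= val_scale.
Qed.

Lemma q_eqP U V : q U = q V <-> exists t : Runits R, U = t *^ V.
Proof.
split.
  by move/(@eqmodP _ (unit_equiv_rel D C)) => /asboolP[t /val_eq_scale UV];
    exists t.
move=> [t /val_eq_scale UV]; apply/(@eqmodP _ (unit_equiv_rel D C)).
by apply/asboolP; exists t.
Qed.

Lemma q_scale (t : Runits R) U : q (t *^ U) = q U.
Proof. by apply/q_eqP; exists t. Qed.

Lemma q_repr x : q (repr x) = x. Proof. exact: reprK. Qed.

Lemma repr_q U : exists t : Runits R, repr (q U) = t *^ U.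
Proof. exact/q_eqP/q_repr. Qed.

Lemma q_ind (P : G -> Prop) : (forall U, P (q U)) -> forall x, P x.
Proof. by move=> Pq x; rewrite -(q_repr x). Qed.

Lemma invG_q U : invG (q U) = q (inv U).
Proof.
change (q (inv (repr (q U))) = q (inv U)).
by have [t ->] := repr_q U; rewrite inv_scale q_scale.
Qed.

Lemma compG_q U V : compG (q U) (q V) <-> comp U V.
Proof.
split=> [[U' [V' [/q_eqP[s ->] /q_eqP[t ->]]]]|UV]; first by move/comp_scale.
by exists U, V.
Qed.

Lemma prdG_q U V : comp U V -> prdG (q U) (q V) = q (prd U V).
Proof.
move=> UV; change (q (prd (repr (q U)) (repr (q V))) = q (prd U V)).
have [s ->] := repr_q U; have [t ->] := repr_q V.
by rewrite prd_scale // q_scale.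
Qed.

Lemma rngG_q U : rngG (q U) = q (rngS U).
Proof. by rewrite /rng invG_q prdG_q //; exact: comp_invr. Qed.

Lemma G_is_groupoid : is_groupoid oG.
Proof.
have [iK assoc ic cV cK] := Sigma_is_groupoid; split.
- by elim/q_ind=> U; rewrite !invG_q iK.
- elim/q_ind=> U; elim/q_ind=> V; elim/q_ind=> W /compG_q UV /compG_q VW.
  have [UVW UVW' e] := assoc _ _ _ UV VW.
  by rewrite !prdG_q // e; split=> //; apply/compG_q.
- by elim/q_ind=> U; rewrite !invG_q; have [] := ic U; split; apply/compG_q.
- elim/q_ind=> U; elim/q_ind=> V /compG_q UV; rewrite !invG_q !prdG_q ?cV //.
  by apply/compP; rewrite rng_prd.
- elim/q_ind=> U; elim/q_ind=> V /compG_q VU; rewrite !invG_q !prdG_q ?cK //.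
  by apply/compP; rewrite src_prd // rng_inv.
Qed.

Lemma unit_spaceGE : unit_space oG = q @` units.
Proof.
apply/seteqP; split=> [_ [x _ <-]|_ [U uU <-]].
  elim/q_ind: x => U; rewrite rngG_q; exists (rngS U) => //; exact: units_rngO.
by exists (q U) => //; rewrite rngG_q rngO_units.
Qed.

Local Notation i := (@i_star R A Gamma D C).

Lemma q_units_inj U V : units U -> units V -> q U = q V -> U = V.
Proof.
move=> uU uV /q_eqP[t UV]; move: (uU); rewrite UV => /(units_scale uV) ->.
by rewrite scale1U.
Qed.

Lemma i_starE (x : set_type (unit_space oG)) U (t : Runits R) :
  units U -> q U = set_val x -> i (x, t) = t *^ U.
Proof.
move=> uU qU; rewrite /i_star /=; congr (_ *^ _); apply: xget_unique => //.
by move=> V [uV qV]; apply: q_units_inj => //; rewrite qV qU.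
Qed.

Lemma unit_point (x : set_type (unit_space oG)) :
  exists2 U, units U & q U = set_val x.
Proof.
have unitsE : unit_space oG `<=` q @` units by rewrite unit_spaceGE.
exact: unitsE (set_valP x).
Qed.

Lemma degree_q U : G_star_degree (q U) = Sigma_star_degree U.
Proof. by rewrite /G_star_degree; have [t ->] := repr_q U;
  exact: degree_scale. Qed.

Lemma operations_well_defined : star_operations_well_defined D C.
Proof.
split; split.
- exact: val_inv.
- exact: val_prd.
- exact: unit_spaceE.
- exact: val_scale.
- exact: degreeE.
- exact: invG_q.
- exact: prdG_q.
- exact: unit_spaceGE.
- by move=> x U t; exact: i_starE.
- exact: degree_q.
Qed.

Lemma q_continuous : continuous (q : Sig -> G).
Proof. exact: pi_continuous. Qed.

(** The saturation of an open set is the union of its translates by units of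
    [R]. *)
Lemma q_open (O : set Sig) : open O -> open (q @` O).
Proof.
move=> /open_ultraP oO.
change (open (q @^-1` (q @` O))); apply/open_ultraP => U [V /oO[n Vn nO]].
move=> /esym/q_eqP[t UV]; exists (sval t *: n); first by rewrite UV;
  exact: scale_mem.
move=> W Wtn; exists (RunitV t *^ W); last exact: q_scale.
by apply: nO; apply/mem_scale => /=; rewrite invrK.
Qed.

Lemma continuous_q (Z : topologicalType) (f : G -> Z) :
  continuous (f \o q) -> continuous f.
Proof. by move/quotient_continuous. Qed.

Lemma q_nbhs U (O : set Sig) : nbhs U O -> nbhs (q U) (q @` O).
Proof.
rewrite nbhsE => -[O' [oO' O'U] O'O]; apply: filterS (image_subset q O'O) _.
by apply: open_nbhs_nbhs; split; [exact: q_open | exists U].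
Qed.

Lemma invG_continuous : continuous (invG : G -> G).
Proof.
apply: continuous_q; have -> : invG \o q = q \o inv.
  by apply/funext => U; exact: invG_q.
by move=> U; apply: continuous_comp;
  [exact: inv_continuous | exact: q_continuous].
Qed.

Lemma rngG_continuous : continuous (rngG : G -> G).
Proof.
apply: continuous_q; have -> : rngG \o q = q \o rngS.
  by apply/funext => U; exact: rngG_q.
by move=> U; apply: continuous_comp;
  [exact: rng_continuous | exact: q_continuous].
Qed.

Lemma prdG_continuous : {within [set p : G * G | compG p.1 p.2],
  continuous (fun p : G * G => prdG p.1 p.2)}.
Proof.
apply/subspace_continuousP => -[]; elim/q_ind=> U; elim/q_ind=> V /compG_q UV O.
move=> nO; have {}nO : nbhs (q (prd U V)) O by rewrite -prdG_q.
move/q_continuous: nO => nO.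
have [m [n [Um Vn mnO]]] := prd_nbhs UV nO.
exists (q @` basic_open m, q @` basic_open n) => /=.
  by split; apply: q_nbhs; apply/nbhs_ultraP; [exists m | exists n].
move=> [_ _] [/= [U' Um' <-] [V' Vn' <-]] /compG_q UV'.
suff: O (prdG (q U') (q V')) by [].
by rewrite prdG_q //; exact: mnO.
Qed.

Lemma G_topological_groupoid : topological_groupoid oG.
Proof.
split; [exact: G_is_groupoid | exact: invG_continuous | exact: prdG_continuous].
Qed.

Lemma q_basic_inj n U V : val U n -> val V n -> q U = q V -> U = V.
Proof.
move=> Un Vn /q_eqP[t UV]; move: Un; rewrite UV => /(scale_free Vn) ->.
by rewrite scale1U.
Qed.

(** Units of [Sigma_star] in the same orbit are equal, so ultrafilters through
    [n] with equivalent ranges have the same range and are equal. *)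
Lemma rngG_inj n : {in q @` basic_open n &, injective rngG}.
Proof.
move=> x y /set_mem[U Un <-] /set_mem[V Vn <-];
  rewrite !rngG_q => /q_units_inj e.
have {}e : rngS U = rngS V by apply: e; exact: units_rngO.
congr q; rewrite -[U]invK -[V]invK; congr inv.
apply: ultra_eq (inv_dag Un) (inv_dag Vn).
by have := congr1 src_of e; rewrite !src_rngO.
Qed.

Lemma rngG_open (O : set G) : open O -> open (rngG @` O).
Proof.
move=> oO; have -> : rngG @` O = q @` (rngS @` (q @^-1` O)).
  apply/seteqP; split=> [_ [x + <-]|_ [_ [U OU <-] <-]].
    elim/q_ind: x => U OU; rewrite rngG_q.
    by exists (rngS U) => //; exists U.
  by exists (q U) => //; exact: rngG_q.
apply/q_open/rng_open; move/continuousP: q_continuous; exact.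
Qed.

(** Source is range after inversion, so that its properties on a basic open set
    follow from those of the range on the inverse basic open set. *)
Lemma srcG_rng x : src oG x = rngG (invG x).
Proof. by rewrite /src /rng; have [-> _ _ _ _] := G_is_groupoid. Qed.

Lemma invG_image (O : set G) : invG @` O = invG @^-1` O.
Proof.
have [iK _ _ _ _] := G_is_groupoid.
by apply/seteqP; split=> [_ [x Ox <-]|x Ox] /=; [rewrite iK | exists (invG x)].
Qed.

Lemma invG_open (O : set G) : open O -> open (invG @` O).
Proof. by rewrite invG_image; move/continuousP: invG_continuous; apply. Qed.

Lemma invG_basic n : N n ->
  invG @` (q @` basic_open n) = q @` basic_open (dag n).
Proof.
move=> Nn; apply/seteqP; split=> [_ [_ [U Un <-] <-]|_ [U Un <-]].
  by rewrite invG_q; exists (inv U) => //; exact: inv_dag.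
exists (q (inv U)); last by rewrite invG_q invK.
by exists (inv U) => //; apply/mem_inv.
Qed.

Lemma q_basic_bisection n : N n -> open_bisection oG (q @` basic_open n).
Proof.
move=> Nn; have oB := q_open (open_basic Nn).
have srcE (O : set G) : src oG @` O = rngG @` (invG @` O).
  rewrite image_comp; congr (_ @` _); apply/funext => x; exact: srcG_rng.
split=> //; first exact: rngG_open.
- by rewrite srcE; apply/rngG_open/invG_open.
- apply: homeo_on_open;
    [exact: continuous_subspaceT rngG_continuous | exact: rngG_inj|].
  by move=> O oO; apply/rngG_open/openI.
- apply: homeo_on_open.
  + apply: continuous_subspaceT; rewrite (_ : src oG = rngG \o invG);
    last first.
      by apply/funext => x; exact: srcG_rng.
    by move=> x; apply: continuous_comp;
      [exact: invG_continuous | exact: rngG_continuous].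
  + move=> x y /set_mem Bx /set_mem By; rewrite !srcG_rng => e.
    have [iK _ _ _ _] := G_is_groupoid; rewrite -[x]iK -[y]iK; congr invG.
    by apply: (@rngG_inj (dag n)) => //; apply/mem_set; rewrite -invG_basic.
  + by move=> O oO; rewrite srcE; apply/rngG_open/invG_open/openI.
Qed.

Lemma G_ample : ample_groupoid oG.
Proof.
split; first exact: G_topological_groupoid.
move=> O; elim/q_ind=> U oO OU.
have [|n Un nO] := @open_nbhs_ultra (q @^-1` O) U _ OU.
  by move/continuousP: q_continuous; exact.
have Nn := ultraN Un; exists (q @` basic_open n); split.
- by apply: continuous_compact (compact_basic Nn);
    exact: continuous_subspaceT q_continuous.
- exact: q_basic_bisection.
- by exists U.
- by move=> _ [V Vn <-]; exact: nO.
Qed.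

(** * The discrete twist *)

Lemma scale_open (t : Runits R) (O : set Sig) :
  open O -> open ((fun U => t *^ U) @` O).
Proof.
move=> /open_ultraP oO; apply/open_ultraP => _ [U /oO[n Un nO] <-].
exists (sval t *: n); first exact: scale_mem.
move=> V Vtn; exists (RunitV t *^ V).
  by apply: nO; apply/mem_scale => /=; rewrite invrK.
apply: val_inj; rewrite /= !val_scale -[in RHS](set_scaleK (RunitV t) (val V)).
congr set_scale; by apply: val_inj => /=; rewrite invrK.
Qed.

(** Translating a section of [q] by units: the common form of [i], where [s] is
    the section over the units, and of the local trivialisations, where [s] is
    the section over the image of a basic open set. *)
Section ScaledSection.
Variables (X : topologicalType) (B : set X) (s : X -> Sig).
Hypothesis s_continuous : {within B, continuous s}.
Hypothesis s_open : forall O, open O -> open (s @` (B `&` O)).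
Hypothesis qs_inj : {in B &, injective (q \o s)}.

Let scaled (p : X * Runits R) : Sig := p.2 *^ s p.1.

Lemma scaled_continuous : {within B `*` [set: Runits R], continuous scaled}.
Proof.
apply/subspace_continuousP => -[x t] [/= Bx _] O /nbhs_ultraP[m /mem_scale sm
  mO].
move/subspace_continuousP: s_continuous => /(_ x Bx (basic_open ((sval t)^-1 *:
  m))).
have sn : nbhs (s x) (basic_open ((sval t)^-1 *: m)).
  by apply/nbhs_ultraP; exists ((sval t)^-1 *: m).
move=> /(_ sn) /= nB.
exists ([set y | B y -> basic_open ((sval t)^-1 *: m) (s y)], [set t]) => /=.
  by split=> //; exact: discrete_set1.
move=> [y u] [/= By ->] [/= {}/By By _]; apply: mO; exact/mem_scale.
Qed.

Lemma scaled_inj : {in B `*` [set: Runits R] &, injective scaled}.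
Proof.
move=> [x t] [y u] /set_mem[/= Bx _] /set_mem[/= By _]; rewrite /scaled /= => e.
have xy : x = y.
  apply: qs_inj; [exact/mem_set | exact/mem_set | rewrite /=].
  by rewrite -(q_scale t) e q_scale.
by rewrite -xy in e *; congr pair; exact: scale_inj e.
Qed.

Lemma scaled_open (O : set (X * Runits R)) :
  open O -> open (scaled @` ((B `*` [set: Runits R]) `&` O)).
Proof.
rewrite !openE => oO U [[x t] [[/= Bx _] Oxt] <-].
have [[P1 P2] [/= nP1 nP2] PO] := oO _ Oxt.
move: nP1; rewrite nbhsE => -[O1 [oO1 O1x] O1P].
apply: (@filterS _ _ _ ((fun U => t *^ U) @` (s @` (B `&` O1)))); last first.
  apply: open_nbhs_nbhs; split; first exact/scale_open/s_open.
  by exists (s x) => //; exists x.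
move=> _ [_ [y [By O1y] <-] <-]; exists (y, t) => //; split=> //.
apply: PO; split; first exact: O1P.
exact: nbhs_singleton nP2.
Qed.

Lemma scaled_homeo : homeo_on (B `*` [set: Runits R])
  (scaled @` (B `*` [set: Runits R])) scaled.
Proof.
apply: homeo_on_open;
  [exact: scaled_continuous | exact: scaled_inj | exact: scaled_open].
Qed.

End ScaledSection.

(** Outside [q @` W] the default [repr b] still lies above [b], so this is a
    section of [q] everywhere. *)
Definition section_in (W : set Sig) (b : G) : Sig :=
  xget (repr b) [set U | W U /\ q U = b].

Lemma q_section_in (W : set Sig) (b : G) : q (section_in W b) = b.
Proof. by rewrite /section_in; case: xgetP => [_ _ []|] //; rewrite q_repr. Qed.

Section LocalSection.
Variable W : set Sig.
Hypotheses (oW : open W) (q_inj : {in W &, injective q}).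

Lemma section_inE U : W U -> section_in W (q U) = U.
Proof. by move=> WU; apply: xget_unique => // V [WV]; apply: q_inj;
  exact/mem_set. Qed.

Lemma section_in_continuous : {within q @` W, continuous (section_in W)}.
Proof.
apply/subspace_continuousP => _ [U WU <-] O nO.
have {}nO : nbhs U O by rewrite -[U]section_inE.
have nWO : nbhs U (W `&` O) by apply: filterI => //; exact: open_nbhs_nbhs.
apply: filterS (q_nbhs nWO) => _ [V [WV OV] <-] _ /=.
by rewrite /from_subspace section_inE.
Qed.

Lemma section_in_image (O : set G) :
  section_in W @` (q @` W `&` O) = W `&` q @^-1` O.
Proof.
apply/seteqP; split=> [_ [_ [[U WU <-] OU] <-]|U [WU OU]].
  by rewrite section_inE.
by exists (q U); [split=> //; exists U | exact: section_inE].
Qed.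

Lemma section_in_open (O : set G) :
  open O -> open (section_in W @` (q @` W `&` O)).
Proof.
by move=> oO; rewrite section_in_image; apply: openI.
Qed.

End LocalSection.

Lemma q_inj_units : {in units &, injective q}.
Proof. by move=> U V /set_mem uU /set_mem uV; exact: q_units_inj. Qed.

Lemma q_inj_basic n : {in basic_open n &, injective q}.
Proof. by move=> U V /set_mem Un /set_mem Vn; exact: q_basic_inj Un Vn. Qed.

(** The inclusion [i] is a translated section because [q] is injective on the
    open set of units. *)
Lemma i_starE_section (p : set_type (unit_space oG) * Runits R) :
  i p = p.2 *^ section_in units (set_val p.1).
Proof.
case: p => x t /=; have [U uU qU] := unit_point x; rewrite (i_starE t uU qU).
by rewrite -qU section_inE //; exact: q_inj_units.
Qed.

Local Notation G0 := (set_type (unit_space oG)).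

Definition unit_section (x : G0) : Sig := section_in units (set_val x).

Lemma unit_section_continuous : continuous unit_section.
Proof.
move=> x O nO.
have /subspace_continuousP := section_in_continuous units_open q_inj_units.
rewrite -unit_spaceGE => /(_ _ (set_valP x) O nO) nx.
have {}nx : nbhs x (set_val @^-1` [set y | unit_space oG y ->
  O (section_in units y)]).
  exact: (@initial_continuous (G0) G set_val).
have sub : set_val @^-1` [set y | unit_space oG y -> O (section_in units y)]
    `<=` unit_section @^-1` O.
  by move=> y; apply; exact: set_valP.
exact: filterS sub nx.
Qed.

Lemma unit_section_open (O : set (G0)) : open O ->
  open (unit_section @` ([set: G0] `&` O)).
Proof.
move=> [O' oO' <-]; rewrite setTI.
have -> : unit_section @`
    (set_val @^-1` O') = section_in units @` (q @` units `&` O').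
  rewrite -unit_spaceGE; apply/seteqP; split=> [_ [x O'x <-]|_ [y [uy O'y] <-]].
    by exists (set_val x) => //; split=> //; exact: set_valP.
  by exists (exist _ y (mem_set uy)).
by apply: section_in_open => //; [exact: units_open | exact: q_inj_units].
Qed.

Lemma unit_section_inj : {in [set: G0] &,
  injective (q \o unit_section)}.
Proof. by move=> x y _ _ /=;
  rewrite /unit_section !q_section_in => /val_inj. Qed.

Lemma i_star_eq : i = fun xt : G0 * Runits R => xt.2 *^ unit_section xt.1.
Proof. by apply/funext => p; exact: i_starE_section. Qed.

Lemma i_continuous : continuous i.
Proof.
rewrite i_star_eq; apply/continuous_subspace_setT; rewrite -setXTT.
exact/scaled_continuous/continuous_subspaceT/unit_section_continuous.
Qed.

Lemma i_inj : injective i.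
Proof.
rewrite i_star_eq => xt yu e; apply: (scaled_inj unit_section_inj) e;
  by apply/mem_set; split.
Qed.

Lemma i_open (O : set (G0 * Runits R)) : open O -> open (i @` O).
Proof.
by rewrite i_star_eq => /(scaled_open unit_section_open); rewrite setXTT setTI.
Qed.

Lemma i_rng0 U (t : Runits R) : i (rng0 oG (q U), t) = t *^ rngS U.
Proof.
by apply: i_starE; [exact: units_rngO | rewrite -rngG_q].
Qed.

Lemma RunitM1 (t : Runits R) : RunitM t (Runit1 R) = t.
Proof. by apply: val_inj => /=; rewrite mulr1. Qed.

Lemma Runit1M (t : Runits R) : RunitM (Runit1 R) t = t.
Proof. by apply: val_inj => /=; rewrite mul1r. Qed.

Lemma comp_rngO U : comp (rngS U) U.
Proof. by apply/compP; rewrite src_rngO. Qed.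

Lemma prd_rngO U : prd (rngS U) U = U.
Proof.
have [u Uu] := ultra_ex U; have cU := @comp_rngO U.
have Ru : val (rngS U) (u ** dag u).
  by apply: prd_mem => //; [exact: comp_invr | exact: inv_dag].
apply: (@ultra_eq _ _ u) => //; first exact: src_prd.
by rewrite -[u](mulNdN (ultraN Uu)); exact: prd_mem.
Qed.

Lemma prd_unit_scale (t : Runits R) U : prd (t *^ rngS U) U = t *^ U.
Proof.
rewrite -[U in prd _ U]scale1U prd_scale ?RunitM1 ?prd_rngO //;
  exact: comp_rngO.
Qed.

Lemma comp_srcO U : comp U (rngS (inv U)).
Proof. by apply/compP; rewrite units_rng ?src_rngO ?rng_inv //;
  exact: units_rngO. Qed.

Lemma prd_scale_unit (t : Runits R) U : prd U (t *^ rngS (inv U)) = t *^ U.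
Proof.
have cU := @comp_srcO U.
rewrite -[U in prd U _]scale1U prd_scale // Runit1M; congr (_ *^ _).
have [u Uu] := ultra_ex U.
have Ru : val (rngS (inv U)) (dag u ** u).
  by apply: prd_mem; [exact: comp_invr | exact: inv_dag | rewrite invK].
apply: (@ultra_eq _ _ u) => //; first by rewrite src_prd // src_rngO rng_inv.
by rewrite -[u](mulNdN (ultraN Uu)) -mulgA; exact: prd_mem.
Qed.

Lemma twist_DT1 : DT1 i q.
Proof.
split; last by move=> x; exists (repr x); exact: q_repr.
  move=> x; have [U uU qU] := unit_point x.
  apply/seteqP; split=> [_ [t _ <-]|V /=].
    by rewrite /= (i_starE t uU qU) q_scale.
  rewrite -qU => /q_eqP[t ->]; exists t => //; exact: i_starE.
exact: i_inj.
Qed.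

(** Over the image of a basic open set the product with [i (r b, t)] is
    translation by [t], so the trivialisation is a translated section. *)
Lemma twist_DT2 : DT2 (Sigma_star_groupoid D C) i q.
Proof.
elim/q_ind=> U; have [n Un] := ultra_ex U; have Nn := ultraN Un.
pose s := section_in (basic_open n).
have op := open_basic Nn; have inj := @q_inj_basic n.
exists (q @` basic_open n), s; split.
- exact: q_basic_bisection.
- by exists U.
- exact: section_in_continuous.
- by move=> b _; exact: q_section_in.
pose F (bt : G * Runits R) : Sig := bt.2 *^ s bt.1.
have -> : (fun bt : G * Runits R => prd (i (rng0 oG bt.1, bt.2)) (s bt.1)) = F.
  apply/funext => -[b t] /=; rewrite /F /= -prd_unit_scale -i_rng0.
  by rewrite q_section_in.
have -> : q @^-1` (q @` basic_open n) =
    F @` ((q @` basic_open n) `*` [set: Runits R]).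
  apply/seteqP; split=> [V [W Wn /esym/q_eqP[t ->]]|_ [[b t] [/= [V Vn <-] _]
    <-]].
    exists (q W, t); first by split=> //; exists W.
    by rewrite /F /= /s section_inE.
  by exists V => //; rewrite /F /= q_scale q_section_in.
apply: scaled_homeo.
- exact: section_in_continuous.
- exact: section_in_open.
- by move=> b c _ _ /=; rewrite !q_section_in.
Qed.

Lemma twist_DT3 : DT3 (Sigma_star_groupoid D C) i q.
Proof.
by move=> U t; rewrite !i_rng0 prd_unit_scale prd_scale_unit.
Qed.

Lemma unit_space_image_i : unit_space (Sigma_star_groupoid D C) =
  i @` [set xt | xt.2 = Runit1 R].
Proof.
rewrite unit_spaceE; apply/seteqP; split=> [U uU|_ [[x t] /= -> <-]].
  by exists (rng0 oG (q U), Runit1 R); rewrite // i_rng0 scale1U rngO_units.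
by have [U uU qU] := unit_point x; rewrite (i_starE _ uU qU) scale1U.
Qed.

Lemma i_hom : groupoid_hom (trivial_bundle R G0) (Sigma_star_groupoid D C) i.
Proof.
move=> [x t] [y u] /= xy; rewrite -{y}xy.
 have [U uU qU] := unit_point x.
have UU : comp U U by apply/compP; rewrite units_rng.
rewrite !(i_starE _ uU qU) prd_scale //; split; first exact/comp_scale.
have UUU : prd U U = U by rewrite -{1}(rngO_units uU) prd_rngO.
by rewrite UUU.
Qed.

Lemma i_units_homeo : homeo_on [set xt | xt.2 = Runit1 R]
  (unit_space (Sigma_star_groupoid D C)) i.
Proof.
rewrite unit_space_image_i; apply: homeo_on_open.
- exact: continuous_subspaceT i_continuous.
- by move=> x y _ _; exact: i_inj.
- move=> O oO; apply/i_open/openI => //.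
  have -> : [set xt : G0 * Runits R |
    xt.2 = Runit1 R] = snd @^-1` [set Runit1 R] by [].
  by move: (Runit1 R) => t; apply: open_comp => [xt _|];
    [exact: cvg_snd | exact: discrete_open].
Qed.

Lemma q_hom : groupoid_hom (Sigma_star_groupoid D C) oG q.
Proof. by move=> U V UV; split; [exact/compG_q | rewrite prdG_q]. Qed.

Lemma q_units_homeo :
  homeo_on (unit_space (Sigma_star_groupoid D C)) (unit_space oG) q.
Proof.
rewrite unit_spaceE unit_spaceGE; apply: homeo_on_open.
- exact: continuous_subspaceT q_continuous.
- exact: q_inj_units.
- by move=> O oO; apply/q_open/openI => //; exact: units_open.
Qed.

Lemma degree_continuous :
  continuous (@Sigma_star_degree R A Gamma D C : Sig ->
    discrete_topology Gamma).
Proof.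
move=> U O /nbhs_singleton OU; apply/nbhs_ultraP.
have [u Uu] := ultra_ex U; exists u => // V Vu /=.
by rewrite (degreeE Vu (ultra_degree Uu)).
Qed.

Lemma degree_comp_q : @Sigma_star_degree R A Gamma D C = @G_star_degree R A
  Gamma D C \o q.
Proof. by apply/funext => U /=; rewrite degree_q. Qed.

Lemma graded_twist : graded_discrete_twist (Sigma_star_groupoid D C) i q
  (@Sigma_star_degree R A Gamma D C) (@G_star_degree R A Gamma D C).
Proof.
split; last split.
- split; first by split; [exact: G_ample | exact: Sigma_topological_groupoid
    | exact: unit_space_image_i].
  split; first by split;
    [exact: i_continuous | exact: i_hom | exact: i_units_homeo].
  split; first by split;
    [exact: q_continuous | exact: q_hom | exact: q_units_homeo].
  by split; [exact: twist_DT1 | exact: twist_DT2 | exact: twist_DT3].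
- exact: degree_continuous.
- by apply: continuous_q; rewrite -degree_comp_q; exact: degree_continuous.
- by move=> U V UV; split=> //; exact: degree_prd.
- elim/q_ind=> U; elim/q_ind=> V /compG_q UV; split=> //.
  by rewrite prdG_q // !degree_q; exact: degree_prd.
- exact: degree_comp_q.
Qed.

(** * Hausdorffness from the conditional expectation *)

Section Hausdorff.
Hypotheses (indecR : indecomposable R) (spanC : C = lin_span (idems C)).

(** An element of [C] is a combination of finitely many idempotents, so it is a
    scalar near each ultrafilter. *)
Lemma scalar_near U c : C c ->
  exists t : R, exists2 f, src_of U f & c ** f = t *: f.
Proof.
rewrite {1}spanC => -[s sE ->]; elim: s sE => [|[r e] s IHs] sE.
  have [u Uu] := ultra_ex U; exists 0, (dag u ** u); first exact: src_of_dagN.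
  by rewrite big_nil nu_mul0l scale0r.
have [|t [f Sf sf]] := IHs; first by move=> p ps; apply: sE;
  rewrite inE ps orbT.
have Ee : E e by apply: (sE (r, e)); rewrite inE eqxx.
have Ef := src_of_E Sf.
rewrite big_cons /=; have [Se|[g Sg eg]] := src_of_dec U Ee.
  exists (r + t), (e ** f); first exact: src_of_mul.
  rewrite nuMDl scalerDl -nuZAl mulgA E_idem //; congr (_ + _)%R.
  by rewrite (E_comm Ee Ef) mulgA sf nuZAl.
have Eg := src_of_E Sg.
exists t, (f ** g); first exact: src_of_mul.
rewrite nuMDl -nuZAl (E_comm Ef Eg) mulgA eg nu_mul0l scaler0 add0r.
by rewrite (E_comm Eg Ef) mulgA sf nuZAl.
Qed.

Variable P : A -> A.
Hypothesis condP : conditional_expectation (D 1%g) C P.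
Hypothesis implP : implemented_by_idempotents (D 1%g) C P.

Lemma expectation0 : P 0 = 0.
Proof. by have [_ _ PC _] := condP; exact/PC/C0. Qed.

Lemma expectation_scale t b : D 1%g b -> P (t *: b) = t *: P b.
Proof.
move=> Db; have [_ Plin _ _] := condP.
have D0 : D 1%g 0 by exact/C_deg1/C0.
by rewrite -[t *: b]addr0 Plin // expectation0 addr0.
Qed.

Lemma expectation_mul c b c' : C c -> D 1%g b -> C c' ->
  P (c ** b ** c') = c ** P b ** c'.
Proof. by have [_ _ _] := condP; apply. Qed.

Lemma expectation_C c : C c -> P c = c.
Proof. by have [_ _ + _] := condP; apply. Qed.

Lemma expectation_in_C b : D 1%g b -> C (P b).
Proof. by have [+ _ _ _] := condP; apply. Qed.

(** The inverse [a] of [t *: f] satisfies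
    [t *: f = t ^ 2 *: (f ** P a ** f)]; near the ultrafilter [P a] is a scalar
    [s] and [t = t * t * s]. Hence [t * s] is an idempotent of [R], nonzero
    because [t] is. *)
Lemma scalar_member_unit U t f : val U (t *: f) -> src_of U f ->
  t \is a GRing.unit.
Proof.
move=> Utf Sf; have Ef := src_of_E Sf; have Cf := E_C Ef.
have Ntf := ultraN Utf; have Dtf : D 1%g (t *: f) by exact/D_scale/C_deg1.
have Da : D 1%g (dag (t *: f)) by rewrite -invg1; exact: D_dag.
set a := dag (t *: f) in Da.
have tfE : t *: f = (t * t)%R *: (f ** P a ** f).
  rewrite -expectation_mul // -expectation_scale; last first.
    by rewrite -[1%g]mulg1 -[(1 * 1)%g]mulg1; do 2?apply: D_mul => //;
      exact: C_deg1.
  rewrite -[LHS]expectation_C; last exact: C_scale.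
  by rewrite -{1}(mulNdN Ntf) -/a -!(nuZAl, nuZAr) scalerA.
have [s [h Sh Pah]] := scalar_near U (expectation_in_C Da).
have Eh := src_of_E Sh.
have Sfh := src_of_mul Sf Sh.
have ts : t = (t * t * s)%R.
  apply: (nonzero_scalar (src_of_E Sfh)).
    by move=> fh0; rewrite fh0 in Sfh; exact: src_of_neq0 Sfh.
  rewrite nuZAl tfE -nuZAl -(mulgA (f ** P a)) (E_comm Ef Eh) mulgA -(mulgA f)
    Pah.
  by rewrite -nuZAr -nuZAl scalerA -mulgA (E_comm Eh Ef) mulgA E_idem.
have [|ts0|ts1] := indecR (e := (t * s)%R).
- by rewrite [in RHS]ts -!mulrA; congr (_ * _)%R; rewrite mulrCA.
- exfalso; apply: (ultra_neq0 Utf).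
  by rewrite ts -mulrA ts0 mulr0 scale0r.
- by apply/unitrPr; exists s.
Qed.

Lemma deg1_normaliser k : N k -> D 1%g k -> normalisers (D 1%g) C k.
Proof.
move=> Nk Dk; split=> //; exists (dag k).
by have [_ dk kd kC] := N_dagP Nk; split=> //; rewrite -invg1; exact: D_dag.
Qed.

(** Members [n] and [m] with [P (n ** dag m) = 0] separate the classes: a common
    point would contain [n] and a multiple of [m], hence a common restriction
    [p], and [p ** dag p] would be a multiple of [n ** dag m] cut by an
    idempotent, so that [P] would kill a nonzero idempotent. *)
Lemma expectation_separates U (t : Runits R) n m :
  D 1%g (n ** dag m) -> P (n ** dag m) = 0 -> val U n -> val (t *^ U) m ->
    False.
Proof.
move=> Dk Pk0 Un tUm; have Nn := ultraN Un; have Nm := ultraN tUm.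
have tU := svalP t.
move: tUm => /mem_scale Um; have [p [Up pn pm]] := ultra_meet Un Um.
have Np := ultraN Up; have tVU : (sval t)^-1 \is a GRing.unit by rewrite unitrV.
have [d [Ed pd pd']] : exists d, [/\
  E d, p = n ** d & p = (sval t)^-1 *: (m ** d)].
  by exists (dag p ** p); split;
    [exact: E_dagN | rewrite mulgA | rewrite nuZAl mulgA].
have Ed' := E_conj Nn Ed.
have ppE : p ** dag p = sval t *: (n ** d ** dag n ** (n ** dag m) ** (m ** dag
  m)).
  rewrite {1}pd pd' dag_scale //; last exact/N_mul/N_E.
  rewrite invrK -nuZAr dag_mul ?(dag_E Ed) //; last exact: N_E.
  by rewrite !mulgA mulEE // -(mulNE Nn Ed) (under_mul3 _ (muldNd Nm)).
apply: (ultra_neq0 Up); rewrite -(mulNdN Np).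
rewrite -(expectation_C (E_C (E_Ndag Np))) ppE expectation_scale; last first.
  rewrite -[1%g]mulg1 -[(1 * 1)%g]mulg1; do 2?apply: D_mul => //;
    apply/C_deg1/E_C => //.
  exact: E_Ndag.
rewrite expectation_mul ?Pk0 ?nu_mul0r ?nu_mul0l ?scaler0 ?nu_mul0l //.
  exact: E_C.
exact/E_C/E_Ndag.
Qed.

Lemma G_hausdorff : hausdorff_space G.
Proof.
elim/q_ind=> U; elim/q_ind=> V cl.
have meet n m : val U n -> val V m ->
    exists (Z : Sig) (t : Runits R), val Z n /\ val (t *^ Z) m.
  move=> Un Vm.
  have nU : nbhs (q U) (q @` basic_open n) by apply/q_nbhs/nbhs_ultraP;
    exists n.
  have nV : nbhs (q V) (q @` basic_open m) by apply/q_nbhs/nbhs_ultraP;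
    exists m.
  have [_ [[Z Zn <-] [Z' Z'm /q_eqP[t Z'E]]]] := cl _ _ nU nV.
  by exists Z, t; rewrite -Z'E.
have src_cut (Z : Sig) u e : E e -> val Z (u ** e) -> src_of Z e.
  by move=> Ee Zue; split=> //; exists (u ** e) => //; rewrite mulEE.
have [[n Un] [m Vm]] := (ultra_ex U, ultra_ex V).
have Nn := ultraN Un; have Nm := ultraN Vm.
have sUV : src_of U = src_of V.
  apply: src_of_sub_eq => e Se; have Ee := src_of_E Se.
  have [//|[f Sf ef]] := src_of_dec V Ee; have Ef := src_of_E Sf.
  have [Z [t [Ze tZf]]] := meet _ _ (ultra_cut Un Se) (ultra_cut Vm Sf).
  have Zf := src_cut _ _ _ Ef tZf; rewrite src_scale in Zf.
  by case: (@src_of_neq0 Z); rewrite -ef; apply: src_of_mul Zf;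
    exact: src_cut Ze.
pose g := Sigma_star_degree U.
have Dn : D g n := ultra_degree Un.
have Dm : D g m.
  have [Z [t [Zn tZm]]] := meet _ _ Un Vm.
  have := ultra_degree tZm; rewrite degree_scale (degreeE Zn Dn); exact.
have UV : comp U (inv V) by apply/compP; rewrite rng_inv.
pose W := prd U (inv V).
have sW : src_of W = rng_of V by rewrite src_prd.
pose k := n ** dag m.
have Wk : val W k by apply: prd_mem => //; exact: inv_dag.
have Nk := ultraN Wk.
have Dk : D 1%g k by rewrite -(mulgV g); apply: D_mul => //; exact: D_dag.
have [e Ee [Pk ke]] := implP (deg1_normaliser Nk Dk).
have [Se|[f Sf ef]] := src_of_dec W Ee.
  have Cke : C (k ** e) by rewrite -Pk; exact: expectation_in_C.
  have [t [f Sf kef]] := scalar_near W Cke.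
  have Wtf : val W (t *: f) by rewrite -kef; apply/ultra_cut/Sf/ultra_cut.
  have tU := scalar_member_unit Wtf Sf.
  (* [U] and [t V] have the same source, and both contain [t *: f ** m]: the
     product of [t *: f] in [U V^-1] with [m], and [t] times [f ** m]. *)
  pose t' : Runits R := exist (fun t : R => is_true (t \is a GRing.unit)) t tU.
  apply/q_eqP; exists t'; apply: (@ultra_eq _ _ (t *: f ** m)).
  - by rewrite src_scale.
  - have [_ _ _ _ /(_ (inv V) U UV)] := Sigma_is_groupoid; rewrite invK => <-.
    by apply: prd_mem => //; apply/compP; rewrite sW.
  - by rewrite -nuZAl; apply: (scale_mem t'); apply: ultra_cutl => //;
      rewrite -sW.
(* Replacing [m] by [f ** m] makes [P] vanish on the product. *)
have Rf : rng_of V f by rewrite -sW.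
have Ef := src_of_E Sf.
have Vfm := ultra_cutl Vm Rf.
have kfE : n ** dag (f ** m) = k ** dag k ** k ** f.
  by rewrite dag_mul ?(dag_E Ef) ?mulNdN ?mulgA //; exact: N_E.
have [Z [t [Zn tZfm]]] := meet _ _ Un Vfm.
exfalso; apply: (expectation_separates _ _ Zn tZfm).
  rewrite kfE mulNdN // -[1%g]mulg1; apply: D_mul => //; exact/C_deg1/E_C.
rewrite kfE (expectation_mul (E_C (E_Ndag Nk)) Dk (E_C Ef)) Pk.
by rewrite -mulgA -(mulgA k e f) ef !nu_mul0r.
Qed.

End Hausdorff.
End GradedPair.

Theorem theorem5p9 (R : comUnitRingType) (Gamma : groupType) (A : nuAlgType R)
    (D : Gamma -> set A) (C : set A)
    (indecR : indecomposable R)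
    (gradA : is_grading D)
    (subC : subalgebra C)
    (comC : commutative_on C)
    (C_deg1 : (C `<=` D 1%g)%classic)
    (wtC : without_torsion C)
    (luC : local_units (D 1%g) (idems C))
    (spanC : C = lin_span (idems C))
    (spanA : lin_span (Nstar D C) = [set: A]%classic) :
  [/\ star_operations_well_defined D C,
      graded_discrete_twist (Sigma_star_groupoid D C)
        (@i_star R A Gamma D C) (@q_star R A Gamma D C)
        (@Sigma_star_degree R A Gamma D C) (@G_star_degree R A Gamma D C) &
      graded_algebraic_quasi_Cartan_pair D C -> hausdorff_space (G_star D C)].
Proof.
split; [exact: operations_well_defined | exact: graded_twist |].
move=> [[_ _ _ _ [P [condP _ implP]]] _].
exact: G_hausdorff condP implP.
Qed.
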